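(* Let $s\in(0,1)$, $n\ge 1$, and $2<q<\frac{2^*_n+2}{2}$. There exists $d^*>0$ such that for every $d>d^*$ the problem \[ \begin{cases} d(-\Delta)^s u+u=u^{q-1}&\text{in }B,\\ u\ge 0&\text{in }B,\\ \mathcal N_s u=0&\text{in }\mathbb R^n\setminus \overline B \end{cases} \] admits only constant solutions, where solutions are understood in the weak sense specified in the context.
   Context: $B$ is the open unit ball of $\mathbb R^n$ centered at the origin, and $B^c=\mathbb R^n\setminus B$. The critical exponent is $2^*_n:=\frac{2n}{n-2s}$ if $0<s<\frac n2$, and $2^*_n:=+\infty$ if $s\ge \frac n2$ (in the latter case the condition $q<\frac{2_n^*+2}{2}$ is void). The fractional Laplacian is $(-\Delta)^su(x):=c_{n,s}\,\mathrm{PV}\int_{\mathbb R^n}\frac{u(x)-u(y)}{|x-y|^{n+2s}}dy$, with $c_{n,s}>0$ the usual normalization constant depending only on $n,s$, and the nonlocal normal derivative is $\mathcal N_s u(x):=c_{n,s}\int_B\frac{u(x)-u(y)}{|x-y|^{n+2s}}dy$ for $x\in\mathbb R^n\setminus\overline B$. For measurable $u:\mathbb R^n\to\mathbb R$ set \[ [u]_{H^s_{B,0}}:=\left(\frac{c_{n,s}}{2}\iint_{\mathbb R^{2n}\setminus(B^c)^2}\frac{|u(x)-u(y)|^2}{|x-y|^{n+2s}}dx\,dy\right)^{1/2}, \] and $H^s_{B,0}:=\{u:\mathbb R^n\to\mathbb R \text{ measurable}: u\in L^2(B),\ [u]_{H^s_{B,0}}<\infty\}$, with norm $\|u\|_{H^s_{B,0}}=(\|u\|_{L^2(B)}^2+[u]^2_{H^s_{B,0}})^{1/2}$.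 A (weak) solution of the problem is a non-negative function $u\in H^s_{B,0}$ such that for every $v\in H^s_{B,0}$ (the integral on the right being finite) \[ d\,\frac{c_{n,s}}{2} \iint_{\mathbb R^{2n}\setminus(B^c)^2}\frac{(u(x)-u(y))(v(x)-v(y))}{|x-y|^{n+2s}}\,dx\,dy + \int_B u\, v\,dx=\int_B u^{q-1}v\, dx. \] *)

(* Defs.v *)
From HB Require Import structures.
From mathcomp Require Import all_boot all_order all_algebra.
From mathcomp Require Import all_classical all_reals all_analysis.

Set Implicit Arguments.
Unset Strict Implicit.
Unset Printing Implicit Defensive.

Import Order.TTheory GRing.Theory Num.Theory.

Local Open Scope classical_set_scope.
Local Open Scope ring_scope.

(* For n.+1 coordinates, the product of the one-dimensional Lebesgue measure
   with a measure on the last n coordinates. *)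
Section cons_measure.
Context {R : realType} (n : nat).
Notation RT := (measurableTypeR R).
Variable nu : {sigma_finite_measure set (n.-tuple RT) -> \bar R}.

Let consT (z : RT * n.-tuple RT) : n.+1.-tuple RT := [tuple of z.1 :: z.2].

Let measurable_consT : measurable_fun setT consT.
Proof. exact: measurable_cons. Qed.

Definition cons_measure : set (n.+1.-tuple RT) -> \bar R :=
  pushforward (lebesgue_measure \x nu)%E consT.

Let cons_measure0 : cons_measure set0 = 0%E.
Proof. by rewrite /cons_measure /pushforward preimage_set0 measure0. Qed.

Let cons_measure_ge0 A : (0 <= cons_measure A)%E.
Proof. exact: measure_ge0. Qed.

Let cons_measure_sigma_additive : semi_sigma_additive cons_measure.
Proof.
move=> F mF tF mUF; rewrite /cons_measure /pushforward preimage_bigcup.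
apply: measure_semi_sigma_additive.
- by move=> k; rewrite -[X in measurable X]setTI; exact: measurable_consT.
- apply/trivIsetP => /= i j _ _ ij; rewrite -preimage_setI.
  by move/trivIsetP : tF => /(_ _ _ _ _ ij) ->//; rewrite preimage_set0.
- by rewrite -preimage_bigcup -[X in measurable X]setTI; exact: measurable_consT.
Qed.

HB.instance Definition _ := isMeasure.Build _ _ _ cons_measure
  cons_measure0 cons_measure_ge0 cons_measure_sigma_additive.

Let cons_measure_sigma_finite : sigma_finite setT cons_measure.
Proof.
have /sigma_finiteP[F [FT ndF Ffin]] := sigma_finiteT (@lebesgue_measure R).
have /sigma_finiteP[H [HT ndH Hfin]] := sigma_finiteT nu.
pose G k := F k `*` H k.
have GT : setT = \bigcup_k G k.
  apply/esym/seteqP; split => // -[x y] _.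
  have [i _ Fx] : (\bigcup_i F i) x by rewrite -FT.
  have [k _ Hy] : (\bigcup_i H i) y by rewrite -HT.
  exists (maxn i k) => //; split => /=.
  - by move: x Fx; exact/subsetPset/ndF/leq_maxl.
  - by move: y Hy; exact/subsetPset/ndH/leq_maxr.
have Gfin k : measurable (G k) /\ ((lebesgue_measure \x nu) (G k) < +oo)%E.
  have [mF fF] := Ffin k; have [mH fH] := Hfin k.
  split; first exact: measurableX.
  by rewrite product_measure1E// lte_mul_pinfty// ge0_fin_numE.
pose h (t : n.+1.-tuple RT) : RT * n.-tuple RT :=
  (tnth t ord0, [tuple of behead t]).
have mh : measurable_fun setT h.
  by apply/measurable_fun_pair => /=;
    [exact: measurable_tnth | exact: measurable_behead].
have hK : cancel consT h.
  by move=> [a t]; rewrite /h /consT /=; congr pair; exact: val_inj.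
exists (fun k => h @^-1` G k).
  by rewrite -preimage_bigcup -GT.
move=> k; have [mG fG] := Gfin k; split.
  by rewrite -[X in measurable X]setTI; exact: mh.
rewrite /cons_measure /pushforward -comp_preimage.
by have -> : h \o consT = id by apply/funext => z; exact: hK.
Qed.

HB.instance Definition _ := Measure_isSigmaFinite.Build _ _ _ cons_measure
  cons_measure_sigma_finite.

End cons_measure.

(* n-dimensional Lebesgue measure on the product of the Borel sigma-algebras. *)
Fixpoint borel_lebesgue (R : realType) (n : nat) :
    {sigma_finite_measure set (n.-tuple (measurableTypeR R)) -> \bar R} :=
  match n with
  | 0 => \d_ [tuple]
  | m.+1 => cons_measure (borel_lebesgue R m)
  end.

(* R^n with the sigma-algebra of Lebesgue-measurable sets, obtained, as for
   completed_lebesgue_measure, as the Caratheodory sigma-algebra. *)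
Definition Rn (R : realType) (n : nat) : Type :=
  caratheodory_type (borel_lebesgue R n)^*%mu.

HB.instance Definition _ (R : realType) (n : nat) := Measurable.on (Rn R n).

Definition lebesgueRn (R : realType) (n : nat) : set (Rn R n) -> \bar R :=
  @completed_measure_extension _ _ _ (borel_lebesgue R n).
Arguments lebesgueRn : clear implicits.

HB.instance Definition _ (R : realType) (n : nat) :=
  Measure.on (lebesgueRn R n).

Lemma lebesgueRn_sigma_finite (R : realType) (n : nat) :
  sigma_finite setT (lebesgueRn R n).
Proof. exact/completed_measure_extension_sigma_finite/sigma_finiteT. Qed.

HB.instance Definition _ (R : realType) (n : nat) :=
  Measure_isSigmaFinite.Build _ _ _ (lebesgueRn R n)
    (lebesgueRn_sigma_finite R n).

Section fractional_neumann.
Context {R : realType} {n : nat}.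
Notation mu := (lebesgueRn R n).
Implicit Types (x y : Rn R n) (u v : Rn R n -> R) (s q d : R).

Definition coord x (i : 'I_n) : R := tnth x i.

Definition enorm x : R := Num.sqrt (\sum_(i < n) coord x i ^+ 2).

Definition edist x y : R := Num.sqrt (\sum_(i < n) (coord x i - coord y i) ^+ 2).

Definition unitB : set (Rn R n) := [set x | enorm x < 1].

(* The usual normalization of the fractional Laplacian, for which it has
   Fourier symbol |xi|^(2s):
     c_{n,s} = (\int_{R^n} (1 - cos z_1) / |z|^(n+2s) dz)^-1
             = 4^s s Gamma(n/2 + s) / (pi^(n/2) Gamma(1 - s)).
   The first coordinate z_1 is nth 0 z 0, so that n need not be a successor. *)
Definition c_ns s : R :=
  (\int[mu]_z ((1 - cos (nth (0 : R) z 0)) / enorm z `^ (n%:R + 2 * s)))^-1.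

(* On the diagonal, which is null, the kernel is read as 0 (0 `^ a = 0 for
   a != 0 and 0^-1 = 0). *)
Definition frac_kernel s x y : R := (edist x y `^ (n%:R + 2 * s))^-1.

(* R^{2n} \ (B^c)^2 *)
Definition domQ : set (Rn R n * Rn R n) := ~` (~` unitB `*` ~` unitB).

Definition seminormHB0 s u : \bar R :=
  (((c_ns s / 2)%:E *
    \int[(mu \x mu)%E]_(z in domQ)
      (`|u z.1 - u z.2| ^+ 2 * frac_kernel s z.1 z.2)%:E) `^ 2^-1)%E.

Definition in_HB0 s u : Prop :=
  [/\ measurable_fun setT u,
      (\int[mu]_(x in unitB) (`|u x| ^+ 2)%:E < +oo)%E &
      (seminormHB0 s u < +oo)%E].

(* As elements of H^s_{B,0}, functions matter up to null sets, so u >= 0 is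
   required almost everywhere. Rintegral is total: finiteness of the right-hand
   side is the integrability conjunct, and the integrals on the left converge
   absolutely, by Cauchy-Schwarz. *)
Definition weak_solution s q d u : Prop :=
  [/\ in_HB0 s u,
      {ae mu, forall x, 0 <= u x} &
      forall v, in_HB0 s v ->
        mu.-integrable unitB (fun x => (u x `^ (q - 1) * v x)%:E) /\
        d * (c_ns s / 2) *
          (\int[(mu \x mu)%E]_(z in domQ)
            ((u z.1 - u z.2) * (v z.1 - v z.2) * frac_kernel s z.1 z.2)) +
          \int[mu]_(x in unitB) (u x * v x) =
        \int[mu]_(x in unitB) (u x `^ (q - 1) * v x)].

End fractional_neumann.

(* 2^*_n *)
Definition critical_exponent (R : realType) (n : nat) (s : R) : \bar R :=
  if s < n%:R / 2 then (2 * n%:R / (n%:R - 2 * s))%:E else +oo%E.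

(* Main.v *)
Require Import Defs.
From mathcomp Require Import all_boot all_order all_algebra.
From mathcomp Require Import all_classical all_reals all_analysis.
From mathcomp Require Import measurable_realfun ring lra.
(* Last, so that [coord] means the coordinates of a point of R^n and not those
   of a vector on a basis. *)
Import Defs.

(** Write [r = q - 1].  Testing the equation with [v = 1] gives
    [\int_B u = \int_B u^r], and since [u <= K + u^r / 2] these two integrals,
    hence also the mean [m] of [u] over [B], are bounded independently of [d]
    ([solution_mass_le]).  Testing with [v = u - m] bounds [d] times the
    Gagliardo energy [E] of [u] by [\int_B (u^r - m^r) (u - m)].  With
    [u - m = sqrt E * w], the integrand is at most a constant times
    [E (u^r + m^r + |w|^(2r))] ([reaction_le]).  The hypothesis on [q] says
    exactly that [2r] lies below the Sobolev exponent, so that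
    [\int_B |w|^(2r)] is at most a constant depending on [n], [s], [q] only,
    because [w] has mean zero and energy one ([subcritical_sobolev]).  Hence
    [d E <= C E], and [E = 0] as soon as [d > C].  A function of zero energy
    is constant, because the domain of integration contains [B x R^n]
    ([gagliardo_eq0_cst]).

    The Sobolev inequality is obtained from level sets.  If the set
    [A = {|f| >= l}] has at most half the volume of a cube of side of order
    [rho], then a point of [{|f| >= l + t}] sees at distance at most [2 rho] a
    portion of [B \ A] of volume of order [rho^n], and contributes at least
    [t^2 rho^(-(n+2s)) rho^n] to the energy ([superlevel_decay]).  Along the
    levels [L 2^k] and the scales [b^(k+1)] this forces the level sets to decay
    like [b^(nk)] ([superlevel_geometric]); the induction starts from the
    Poincare and Chebyshev inequalities.  Some [b < 1] satisfies both
    [b^(2s) <= 4 b^n], which closes the induction, and [2^p b^n < 1], which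
    makes [|f|^p] summable, precisely when [p] is subcritical
    ([subcritical_ratio]).

    All this requires [c_ns s > 0].  As [c_ns s] is the inverse of an integral,
    it would vanish if that integral were infinite; finiteness is checked on
    dyadic annuli ([c_ns_gt0]). *)

Set Implicit Arguments.
Unset Strict Implicit.
Unset Printing Implicit Defensive.

Import Order.TTheory GRing.Theory Num.Theory.
Import numFieldNormedType.Exports.

Local Open Scope classical_set_scope.
Local Open Scope ring_scope.

(** * Cubes and the unit ball of R^n *)

Section boxes.
Context {R : realType}.
Notation RT := (measurableTypeR R).

Definition box n (z : n.-tuple RT) (h : R) : set (n.-tuple RT) :=
  [set x | forall i, `|tnth x i - tnth z i| < h].

Lemma measurable_box n (z : n.-tuple RT) h : measurable (box z h).
Proof.
have -> : box z h = \bigcap_(i in [set: 'I_n])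
    ((fun x : n.-tuple RT => tnth x i) @^-1` ball (tnth z i : R) h).
  apply/seteqP; split => [x xz i _|x xz i]; first by rewrite /= /ball/= distrC.
  by have := xz i I; rewrite /= /ball/= distrC.
apply: fin_bigcap_measurable => [|i _]; first exact: finite_finset.
rewrite -[X in measurable X]setTI.
by apply: (@measurable_tnth _ RT) => //; exact: measurable_ball.
Qed.

Lemma borel_lebesgue_box n (z : n.-tuple RT) h : 0 <= h ->
  borel_lebesgue R n (box z h) = ((h *+ 2) ^+ n)%:E.
Proof.
move=> h0; elim: n z => [|n ih] z.
  by rewrite /= diracE mem_set// => -[].
case/tupleP: z => z0 z.
have -> : borel_lebesgue R n.+1 (box [tuple of z0 :: z] h) =
    (lebesgue_measure \x borel_lebesgue R n)%E (ball (z0 : R) h `*` box z h).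
  rewrite /= /cons_measure /pushforward; congr (_ _).
  apply/seteqP; split => [[a t] /= H|[a t] /= [H1 H2] i].
    split; first by have := H ord0; rewrite !tnth0 /ball/= distrC.
    by move=> i; have := H (lift ord0 i); rewrite !tnthS.
  case: (unliftP ord0 i) => [j|] ->.
    by rewrite !tnthS; exact: H2.
  by rewrite !tnth0; move: H1; rewrite /ball/= distrC.
rewrite product_measure1E//.
- have := lebesgue_measure_ball (z0 : R) h0.
  by rewrite ih => /= ->; rewrite -EFinM exprS.
- exact: measurable_ball.
- exact: measurable_box.
Qed.

End boxes.

Section lebesgue_on_Rn.
Context {R : realType} {n : nat}.
Notation mu := (lebesgueRn R n).
Notation RT := (measurableTypeR R).
Implicit Types x y z : Rn R n.

Lemma borel_measurable_Rn (A : set (n.-tuple RT)) :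
  measurable A -> measurable (A : set (Rn R n)).
Proof.
by move=> mA; exact: (caratheodory_measurable_mu_ext (borel_lebesgue R n)).
Qed.

Lemma lebesgueRn_box (z : n.-tuple RT) h : 0 <= h ->
  mu (box z h) = ((h *+ 2) ^+ n)%:E.
Proof.
move=> h0; rewrite /lebesgueRn /completed_measure_extension measurable_mu_extE.
  exact: borel_lebesgue_box.
exact: measurable_box.
Qed.

Lemma measurable_coord (i : 'I_n) :
  measurable_fun [set: Rn R n] (fun x => coord x i).
Proof.
move=> _ Y mY; rewrite setTI; apply: borel_measurable_Rn.
by rewrite -[X in measurable X]setTI; exact: (@measurable_tnth _ RT).
Qed.

Lemma measurable_sqrt : measurable_fun [set: R] (@Num.sqrt R).
Proof. by apply: continuous_measurable_fun; exact: sqrt_continuous. Qed.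

Lemma measurable_enorm : measurable_fun [set: Rn R n] enorm.
Proof.
apply: (measurableT_comp measurable_sqrt); apply: measurable_sum => i.
exact/measurable_funX/measurable_coord.
Qed.

Lemma measurable_edist :
  measurable_fun [set: Rn R n * Rn R n] (fun z : Rn R n * Rn R n => edist z.1 z.2).
Proof.
apply: (measurableT_comp measurable_sqrt); apply: measurable_sum => i.
apply/measurable_funX/measurable_funB.
  exact: (measurableT_comp (f := fun x => coord x i) (g := fst)
    (measurable_coord i) measurable_fst).
exact: (measurableT_comp (f := fun x => coord x i) (g := snd)
  (measurable_coord i) measurable_snd).
Qed.

Lemma measurable_frac_kernel s : measurable_fun [set: Rn R n * Rn R n]
  (fun z : Rn R n * Rn R n => frac_kernel s z.1 z.2).
Proof.
rewrite /frac_kernel; under eq_fun do rewrite -powRN.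
exact: (measurableT_comp (measurable_powR _) measurable_edist).
Qed.

Lemma measurable_unitB : measurable (unitB : set (Rn R n)).
Proof.
rewrite /unitB -[X in measurable X]setTI.
exact: (measurable_fun_ltr measurable_enorm (measurable_cst (1 : R))).
Qed.

Lemma measurable_domQ : measurable (domQ : set (Rn R n * Rn R n)).
Proof.
apply: measurableC; apply: measurableX; apply: measurableC.
  exact: measurable_unitB.
exact: measurable_unitB.
Qed.

Lemma frac_kernel_ge0 s x y : 0 <= frac_kernel s x y.
Proof. by rewrite invr_ge0 powR_ge0. Qed.

Lemma edist_eq0 x y : edist x y = 0 -> x = y.
Proof.
move=> /eqP; rewrite sqrtr_eq0 => xy.
have sum0 : \sum_(i < n) (coord x i - coord y i) ^+ 2 == 0.
  by rewrite eq_le xy sumr_ge0// => i _; exact: sqr_ge0.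
apply: eq_from_tnth => i; apply/eqP; rewrite -subr_eq0 -sqrf_eq0.
move: sum0; rewrite psumr_eq0 => [/allP/(_ i)|j _]; last exact: sqr_ge0.
by apply; exact: mem_index_enum.
Qed.

Lemma enorm_lt1P x : unitB x <-> \sum_(i < n) coord x i ^+ 2 < 1.
Proof.
by rewrite /unitB /= /enorm -[X in _ < X]sqrtr1 ltr_sqrt.
Qed.

Lemma edist_le2 x y : unitB x -> unitB y -> edist x y <= 2.
Proof.
move=> /enorm_lt1P xB /enorm_lt1P yB.
rewrite -[X in _ <= X](ger0_norm (ler0n _ 2)) -sqrtr_sqr.
rewrite ler_sqrt; last by rewrite exprn_ge0.
apply: (@le_trans _ _ (2 * \sum_(i < n) coord x i ^+ 2 +
  2 * \sum_(i < n) coord y i ^+ 2)); last by lra.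
rewrite !mulr_sumr -big_split/=; apply: ler_sum => i _.
have := sqr_ge0 (coord x i + coord y i); nra.
Qed.

(** With [t = y - (1 - rho) x], convexity of the square in each coordinate gives
    [y_i^2 <= (1 - rho) x_i^2 + rho (t_i / rho)^2], and the last terms add up to
    at most [rho]. *)
Lemma box_sub_unitB x y rho : (1 <= n)%N -> 0 < rho < 1 -> unitB x ->
  (forall i, `|coord y i - (1 - rho) * coord x i| < rho / n%:R) ->
  unitB y /\ edist x y <= 2 * rho.
Proof.
move=> n1 /andP[rho0 rho1] /enorm_lt1P xB yz.
have n0 : 0 < n%:R :> R by rewrite ltr0n.
pose t i := coord y i - (1 - rho) * coord x i.
have t2 i : t i ^+ 2 <= rho ^+ 2 / n%:R.
  have h : `|t i| <= rho / n%:R by exact/ltW/yz.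
  rewrite -real_normK ?num_real//.
  apply: (@le_trans _ _ ((rho / n%:R) ^+ 2)).
    by rewrite lerXn2r// ?nnegrE// divr_ge0// ltW.
  rewrite expr_div_n ler_pM2l ?exprn_gt0// lef_pV2 ?posrE ?exprn_gt0//.
  by rewrite ler_eXnr// ler1n.
have st2 : \sum_(i < n) t i ^+ 2 <= rho ^+ 2.
  apply: (@le_trans _ _ (\sum_(i < n) rho ^+ 2 / n%:R)); first exact: ler_sum.
  by rewrite sumr_const card_ord -[_ *+ n]mulr_natr divfK// gt_eqF.
have yE i : coord y i = (1 - rho) * coord x i + t i by rewrite /t; ring.
split.
  apply/enorm_lt1P.
  have : \sum_(i < n) coord y i ^+ 2 <=
      (1 - rho) * \sum_(i < n) coord x i ^+ 2 + rho^-1 * \sum_(i < n) t i ^+ 2.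
    rewrite !mulr_sumr -big_split/=; apply: ler_sum => i _; rewrite yE.
    rewrite -subr_ge0.
    have -> : (1 - rho) * coord x i ^+ 2 + rho^-1 * t i ^+ 2 -
        ((1 - rho) * coord x i + t i) ^+ 2 =
        (1 - rho) * (rho * (coord x i - t i / rho) ^+ 2).
      by field; rewrite gt_eqF.
    by apply: mulr_ge0; [lra|apply: mulr_ge0; [exact: ltW|exact: sqr_ge0]].
  have : rho^-1 * \sum_(i < n) t i ^+ 2 <= rho.
    by rewrite ler_pdivrMl// -expr2.
  set X := \sum_(i < n) _ in xB *; set Y := \sum_(i < n) _; set T := rho^-1 * _.
  move=> hT hY.
  have : (1 - rho) * X < 1 - rho by rewrite gtr_pMr// subr_gt0.
  by lra.
rewrite -[X in _ <= X](@ger0_norm _ (2 * rho)); last by rewrite mulr_ge0// ltW.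
rewrite -sqrtr_sqr ler_sqrt; last by rewrite exprn_ge0// mulr_ge0// ltW.
apply: (@le_trans _ _ (2 * \sum_(i < n) t i ^+ 2 +
    2 * rho ^+ 2 * \sum_(i < n) coord x i ^+ 2)).
  rewrite !mulr_sumr -big_split/=; apply: ler_sum => i _; rewrite yE.
  have := sqr_ge0 (t i + rho * coord x i); nra.
have : rho ^+ 2 * \sum_(i < n) coord x i ^+ 2 <= rho ^+ 2.
  by rewrite ger_pMr ?exprn_gt0// ltW.
nra.
Qed.

End lebesgue_on_Rn.

(** * Integration by layers *)

Lemma dyadic_bracket (R : realType) (x : R) : 1 <= x ->
  exists k, 2 ^+ k <= x < 2 ^+ k.+1.
Proof.
move=> x1; have ex : exists k, x < 2 ^+ k.
  exists (Num.truncn x).+1; apply: (lt_trans (truncnS_gt x)).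
  by rewrite -natrX ltr_nat ltn_expl.
case: (ex_minnP ex) => -[|k] xk kmin; first by rewrite expr0 ltNge x1 in xk.
exists k; rewrite xk andbT leNgt; apply/negP => /kmin.
by rewrite ltnn.
Qed.

Section layers.
Local Open Scope ereal_scope.
Context d (T : measurableType d) (R : realType) (mu : {measure set T -> \bar R}).

(** [f] is dominated by the series of the [a k] times the indicator of [F k],
    which is integrated termwise.  The layers are dyadic annuli in the proof of
    [c_ns_gt0] and level sets in that of [subcritical_sobolev]. *)
Lemma ge0_integral_layers (D : set T) (f : T -> \bar R) (F : (set T)^nat)
    (a : R^nat) (C r : R) :
  measurable D -> measurable_fun D f -> (forall x, D x -> 0 <= f x) ->
  (forall k, measurable (F k)) -> (forall k, (0 <= a k)%R) ->
  (forall x, D x -> f x != 0 -> exists2 k, F k x & f x <= (a k)%:E) ->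
  (0 <= C)%R -> (0 < r < 1)%R ->
  (forall k, (a k)%:E * mu (F k) <= (C * r ^+ k)%:E) ->
  \int[mu]_(x in D) f x <= (C / (1 - r))%:E.
Proof.
move=> mD mf f0 mF a0 fF C0 /andP[r0 r1] muF.
have g0 k x : 0 <= (a k)%:E * (\1_(F k) x)%:E.
  by rewrite -EFinM lee_fin mulr_ge0.
have mg k : measurable_fun D (fun x => (a k)%:E * (\1_(F k) x)%:E).
  by apply: measurable_funeM; apply/measurable_EFinP; exact: measurable_indic.
apply: (@le_trans _ _ (\int[mu]_(x in D)
    \sum_(k <oo) ((a k)%:E * (\1_(F k) x)%:E))).
  apply: ge0_le_integral => //.
    exact: ge0_emeasurable_sum.
  move=> x Dx; have [->|fx0] := eqVneq (f x) 0; first exact: nneseries_ge0.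
  have [k Fkx fa] := fF x Dx fx0; apply: (le_trans fa).
  apply: (le_trans _ (nneseries_lim_ge k.+1 _)) => //.
  rewrite big_nat_recr//= indicE mem_set// mule1.
  by rewrite leeDr// sume_ge0.
rewrite integral_nneseries//.
apply: lime_le.
  by apply: is_cvg_nneseries => k _ _; exact: integral_ge0.
apply: nearW => N.
apply: (@le_trans _ _ (\sum_(0 <= k < N) (C * r ^+ k)%:E)).
  apply: lee_sum => k _; rewrite ge0_integralZl ?lee_fin//; last first.
    by apply/measurable_EFinP; exact: measurable_indic.
  rewrite integral_indic//; apply: (le_trans _ (muF k)).
  apply: lee_wpmul2l; first by rewrite lee_fin.
  by rewrite le_measure// ?inE//; exact: measurableI.
rewrite sumEFin lee_fin.
by apply: (@geometric_le_lim R N C r) => //; rewrite (ger0_norm (ltW r0)).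
Qed.

End layers.

(** * Positivity of the normalization constant *)

Section trig.
Context {R : realType}.

Lemma normr_sin_le (x : R) : `|sin x| <= `|x|.
Proof.
wlog x0 : x / 0 <= x.
  move=> H; have [|/ltW x0] := leP 0 x; first exact: H.
  by move: (H (- x)); rewrite sinN !normrN oppr_ge0; exact.
have [|c _] := @MVT_segment R sin cos 0 x x0 (fun y _ => is_derive_sin y).
  by apply: continuous_subspaceT => y; exact: continuous_sin.
rewrite sin0 !subr0 => ->.
by rewrite normrM ler_piMl// cos_max.
Qed.

Lemma subr1_cos (x : R) : 1 - cos x = 2 * sin (x / 2) ^+ 2.
Proof.
have {1}-> : x = (x / 2) *+ 2 by rewrite -mulr_natr divfK.
by rewrite cos_mulr2n cos2sin2; ring.
Qed.

Lemma subr1_cos_le (x : R) : 1 - cos x <= x ^+ 2.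
Proof.
rewrite subr1_cos -[sin _ ^+ 2]real_normK ?num_real//.
have h : `|sin (x / 2)| ^+ 2 <= (x / 2) ^+ 2.
  rewrite -[(x / 2) ^+ 2]real_normK ?num_real//.
  by rewrite lerXn2r ?nnegrE// normr_sin_le.
have := sqr_ge0 x; nra.
Qed.

End trig.

Lemma powRX (R : realType) (b x : R) k : 0 < b -> (b ^+ k) `^ x = (b `^ x) ^+ k.
Proof.
move=> b0; rewrite -(powR_mulrn k (ltW b0)) -(powR_mulrn k (powR_ge0 b x)).
by rewrite -!powRrM mulrC.
Qed.

Lemma powR_gt1 (R : realType) (b x : R) : 1 < b -> 0 < x -> 1 < b `^ x.
Proof.
move=> b1 x0; have b0 : 0 < b := lt_trans ltr01 b1.
have <- : 1 `^ x = 1 by rewrite powR1.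
by rewrite gt0_ltr_powR ?nnegrE// ltW.
Qed.

Lemma powR_lt1 (R : realType) (b x : R) : 0 < b < 1 -> 0 < x -> b `^ x < 1.
Proof.
move=> /andP[b0 b1] x0.
have <- : 1 `^ x = 1 by rewrite powR1.
by rewrite gt0_ltr_powR ?nnegrE// ltW.
Qed.

Section normalization.
Context {R : realType} {n : nat}.
Notation mu := (lebesgueRn R n).
Implicit Types x y z : Rn R n.

Lemma coord_le_enorm x i : `|coord x i| <= enorm x.
Proof.
rewrite -sqrtr_sqr ler_sqrt; last by apply: sumr_ge0 => j _; exact: sqr_ge0.
by rewrite (bigD1 i)//= lerDl sumr_ge0// => j _; exact: sqr_ge0.
Qed.

Definition box0 (h : R) : set (Rn R n) := box [tuple of nseq n (0 : R)] h.

Lemma enorm_lt_box0 x h : enorm x < h -> box0 h x.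
Proof.
move=> xh i; rewrite tnth_nseq subr0.
exact: le_lt_trans (coord_le_enorm x i) xh.
Qed.

Lemma measurable_box0 h : measurable (box0 h).
Proof. by apply: borel_measurable_Rn; exact: measurable_box. Qed.

Lemma lebesgueRn_box0 h : 0 <= h -> mu (box0 h) = ((h *+ 2) ^+ n)%:E.
Proof. exact: lebesgueRn_box. Qed.

Lemma lebesgueRn_unitB_lty : (mu unitB < +oo)%E.
Proof.
apply: (@le_lt_trans _ _ (mu (box0 1))).
  rewrite le_measure ?inE//.
  - exact: measurable_unitB.
  - exact: measurable_box0.
  - by move=> x; exact: enorm_lt_box0.
by rewrite lebesgueRn_box0// ltry.
Qed.

Section dirichlet.
Variables (s : R) (i0 : 'I_n).
Hypotheses (s_gt0 : 0 < s) (s_lt1 : s < 1).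
Let a : R := n%:R + 2 * s.
Let J z : R := (1 - cos (coord z i0)) / enorm z `^ a.

Let a_gt0 : 0 < a.
Proof. by rewrite /a ltr_wpDl ?ler0n ?mulr_gt0 ?ltr0n. Qed.

Let J_ge0 z : 0 <= J z.
Proof. by rewrite divr_ge0 ?powR_ge0// subr_ge0 cos_le1. Qed.

Let measurable_J : measurable_fun setT J.
Proof.
apply: measurable_funM.
  apply: measurable_funB; first exact: measurable_cst.
  apply: (measurableT_comp (f := cos) _ (measurable_coord i0)).
  by apply: continuous_measurable_fun; exact: continuous_cos.
under eq_fun do rewrite -powRN.
exact: (measurableT_comp (measurable_powR _) measurable_enorm).
Qed.

Let le_J z h c : 0 < h -> h <= enorm z -> 1 - cos (coord z i0) <= c ->
  J z <= c * h `^ (- a).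
Proof.
move=> h0 hz zc; rewrite /J -powRN ler_pM ?powR_ge0 ?subr_ge0 ?cos_le1//.
rewrite !powRN lef_pV2 ?posrE ?powR_gt0//; last exact: lt_le_trans hz.
by rewrite ge0_ler_powR ?nnegrE ?(ltW a_gt0)// (le_trans (ltW h0)).
Qed.

(** Away from the origin [J z <= 2 |z|^(-a)], and the annulus at scale [2^k]
    contributes a multiple of [2^(-2sk)]. *)
Let tail_lty : (\int[mu]_(z in ~` unitB) (J z)%:E < +oo)%E.
Proof.
pose r : R := 2 `^ (- (2 * s)).
apply: (@le_lt_trans _ _ ((2 * 4 ^+ n) / (1 - r))%:E); last exact: ltry.
have mBc : measurable (~` unitB : set (Rn R n)).
  exact/measurableC/measurable_unitB.
have mJ : measurable_fun (~` unitB) (EFin \o J).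
  exact/measurable_EFinP/measurable_funTS.
have r01 : 0 < r < 1.
  by rewrite /r powR_gt0//= powRN invf_lt1 ?powR_gt0// powR_gt1// ?ltr1n// mulr_gt0.
have C0 : 0 <= 2 * 4 ^+ n :> R by rewrite mulr_ge0// exprn_ge0.
have a_ge0 k : 0 <= 2 * (2 ^+ k) `^ (- a) by rewrite mulr_ge0 ?powR_ge0.
apply: (ge0_integral_layers (F := fun k => box0 (2 ^+ k.+1))
  (a := fun k => 2 * (2 ^+ k) `^ (- a)) mBc mJ (fun x _ => J_ge0 x)
  (fun k => measurable_box0 _) a_ge0 _ C0 r01).
- move=> x /negP; rewrite -leNgt => /dyadic_bracket[k /andP[kx xk]] _.
  exists k; first exact: enorm_lt_box0.
  rewrite lee_fin le_J// ?exprn_gt0//.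
  by have := cos_geN1 (coord x i0); lra.
- move=> k; rewrite [X in (_ * X)%E]lebesgueRn_box0 ?exprn_ge0// -EFinM lee_fin.
  rewrite /r -powRX// /a opprD powRD; last by rewrite expf_neq0 ?implybT// pnatr_eq0.
  rewrite (powRN _ n%:R) powR_mulrn ?exprn_ge0// exprS -[(_ * _) *+ 2]mulr_natr.
  have -> : 2 * 2 ^+ k * 2 = 4 * 2 ^+ k :> R by ring.
  rewrite exprMn le_eqVlt; apply/orP; left; apply/eqP.
  by field; rewrite expf_neq0// expf_neq0// pnatr_eq0.
Qed.

(** Near the origin [J z <= |z|^(2-a)], because [1 - cos t <= t^2], and the
    annulus at scale [2^(-k)] contributes a multiple of [2^(-(2-2s)k)]. *)
Let core_lty : (\int[mu]_(z in unitB) (J z)%:E < +oo)%E.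
Proof.
(* [2^k <= 1 / |z| < 2^(k+1)] puts [|z|] between [t^(k+1)] and [t^k]. *)
pose t : R := 2^-1.
have t0 : 0 < t by rewrite /t invr_gt0.
pose r : R := t `^ (2 - 2 * s).
apply: (@le_lt_trans _ _ ((4 ^+ n * t `^ (- a)) / (1 - r))%:E); last exact: ltry.
have mJ : measurable_fun unitB (EFin \o J).
  exact/measurable_EFinP/measurable_funTS.
have s2 : 0 < 2 - 2 * s by move: s_lt1; lra.
have r01 : 0 < r < 1.
  by rewrite /r powR_gt0//= powR_lt1// t0/= invf_lt1// ltr1n.
have C0 : 0 <= 4 ^+ n * t `^ (- a) by rewrite mulr_ge0 ?powR_ge0// exprn_ge0.
have a_ge0 k : 0 <= (t ^+ k) ^+ 2 * (t ^+ k.+1) `^ (- a).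
  by rewrite mulr_ge0 ?powR_ge0// sqr_ge0.
apply: (ge0_integral_layers (F := fun k => box0 (2 * t ^+ k))
  (a := fun k => (t ^+ k) ^+ 2 * (t ^+ k.+1) `^ (- a))
  (@measurable_unitB R n) mJ (fun x _ => J_ge0 x)
  (fun k => measurable_box0 _) a_ge0 _ C0 r01).
- move=> x xB Jx0.
  have x0 : 0 < enorm x.
    rewrite lt_neqAle sqrtr_ge0 andbT; apply: contra Jx0 => /eqP x0.
    have a0 : a != 0 by rewrite gt_eqF.
    by rewrite /= /J -x0 (powR0 a0) invr0 mulr0.
  have : 1 <= (enorm x)^-1 by rewrite invf_ge1// ltW.
  move=> /dyadic_bracket[k /andP[kx xk]].
  have xt : enorm x <= t ^+ k.
    by rewrite exprVn -[enorm x]invrK lef_pV2 ?posrE ?exprn_gt0 ?invr_gt0.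
  exists k.
    apply: enorm_lt_box0; apply: (le_lt_trans xt).
    by rewrite ltr_pMl ?exprn_gt0// ltr1n.
  rewrite lee_fin le_J ?exprn_gt0//.
    by rewrite exprVn invf_ple ?posrE ?exprn_gt0// ltW.
  apply: (le_trans (subr1_cos_le _)).
  rewrite -[coord x i0 ^+ 2]real_normK ?num_real//.
  rewrite lerXn2r ?nnegrE ?exprn_ge0 ?(ltW t0)//.
  exact: le_trans (coord_le_enorm x i0) xt.
- move=> k; rewrite [X in (_ * X)%E]lebesgueRn_box0; last first.
    by rewrite mulr_ge0// exprn_ge0// ltW.
  rewrite -EFinM lee_fin.
  have rE : r = t ^+ 2 * t ^+ n * t `^ (- a).
    rewrite -exprD -powR_mulrn ?(ltW t0)// -powRD ?(gt_eqF t0) ?implybT//.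
    by rewrite /r natrD /a; congr powR; ring.
  rewrite rE powRX// -[(_ * _) *+ 2]mulr_natr.
  have -> : 2 * t ^+ k * 2 = 4 * t ^+ k by ring.
  rewrite !exprMn (exprS _ k) -!exprM (mulnC k 2%N) (mulnC k n) le_eqVlt.
  by apply/orP; left; apply/eqP; rewrite mul2n -addnn exprD; ring.
Qed.

(** [J] is positive on the cube of half-side [1/4] centred at
    [(1/2, ..., 1/2)], which is not null. *)
Let integral_J_neq0 : (\int[mu]_z (J z)%:E != 0)%E.
Proof.
apply/eqP => int0.
have aeJ : ae_eq mu setT (EFin \o J) (cst 0%E).
  have mJ : measurable_fun setT (EFin \o J) by exact/measurable_EFinP.
  apply: (ae_eq_integral_abs mu measurableT mJ).1.
  by rewrite -int0; apply: eq_integral => z _; rewrite /= ger0_norm// J_ge0.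
pose z0 := [tuple of nseq n (2^-1 : R)].
have : mu.-negligible (box z0 4^-1).
  apply: negligibleS aeJ => z zbox /= /(_ I) [].
  have : `|coord z i0 - 2^-1| < 4^-1 by have := zbox i0; rewrite tnth_nseq.
  rewrite ltr_norml => /andP[z1 z2].
  have c0 : 4^-1 < coord z i0 by lra.
  have c1 : coord z i0 < 1 by lra.
  apply/eqP; rewrite gt_eqF// divr_gt0 ?powR_gt0//; last first.
    by apply: lt_le_trans (coord_le_enorm z i0); rewrite gtr0_norm//; lra.
  rewrite subr1_cos mulr_gt0// exprn_gt0// sin2_gt0//.
  by apply/andP; split; lra.
move=> /negligibleP => /(_ (borel_measurable_Rn (measurable_box _ _)))/eqP.
apply/negP; rewrite [X in X == _]lebesgueRn_box ?invr_ge0//.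
Qed.

Lemma dirichlet_constant_gt0 : 0 < \int[mu]_z J z.
Proof.
have J0 z : (0 <= (J z)%:E)%E by rewrite lee_fin J_ge0.
have mB := @measurable_unitB R n.
have mJ : measurable_fun setT (EFin \o J) by exact/measurable_EFinP.
have JE : (\int[mu]_z (J z)%:E =
    \int[mu]_(z in unitB) (J z)%:E + \int[mu]_(z in ~` unitB) (J z)%:E)%E.
  rewrite -(ge0_integral_setU mu mB (measurableC mB)) ?setUv//.
  exact/disj_setPCl.
rewrite /Rintegral fine_gt0// lt0e integral_J_neq0 integral_ge0//=.
by rewrite JE lte_add_pinfty// ?core_lty ?tail_lty.
Qed.

End dirichlet.

Lemma c_ns_gt0 s : (1 <= n)%N -> 0 < s < 1 -> 0 < c_ns (R := R) (n := n) s.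
Proof.
move=> n1 /andP[s0 s1]; rewrite /c_ns invr_gt0.
under eq_fun do rewrite -(tnth_nth 0 _ (Ordinal n1)).
exact: dirichlet_constant_gt0.
Qed.

End normalization.

(** * Gagliardo energy on the unit ball *)

Section energy.
Context {R : realType} {n : nat}.
Notation mu := (lebesgueRn R n).
Implicit Types (x y : Rn R n) (f : Rn R n -> R) (s rho l t : R).

Definition gagliardo s f : \bar R :=
  (\int[(mu \x mu)%E]_(z in domQ)
     (`|f z.1 - f z.2| ^+ 2 * frac_kernel s z.1 z.2)%:E)%E.

(** The volume of the cubes of half-side [rho / n] that [unitB_thick] finds. *)
Definition cube_vol rho : R := (rho / n%:R *+ 2) ^+ n.

(** Centring the cube at [(1 - rho) x] rather than at [x] keeps it inside the
    ball even when [x] is close to the sphere. *)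
Lemma unitB_thick x rho : (1 <= n)%N -> 0 < rho < 1 -> unitB x ->
  exists D : set (Rn R n), [/\ measurable D, D `<=` unitB,
    forall y, D y -> edist x y <= 2 * rho & mu D = (cube_vol rho)%:E].
Proof.
move=> n1 rho01 xB.
exists (box [tuple (1 - rho) * coord x i | i < n] (rho / n%:R)); split.
- by apply: borel_measurable_Rn; exact: measurable_box.
- move=> y xy; apply: (box_sub_unitB n1 rho01 xB _).1 => i.
  by have := xy i; rewrite tnth_mktuple.
- move=> y xy; apply: (box_sub_unitB n1 rho01 xB _).2 => i.
  by have := xy i; rewrite tnth_mktuple.
- by rewrite lebesgueRn_box// divr_ge0//; case/andP: rho01 => /ltW.
Qed.

Lemma measurable_gagliardo_integrand s f : measurable_fun setT f ->
  measurable_fun [set: Rn R n * Rn R n]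
    (fun z => `|f z.1 - f z.2| ^+ 2 * frac_kernel s z.1 z.2).
Proof.
move=> mf; apply: measurable_funM; last exact: measurable_frac_kernel.
apply: measurable_funX; apply: measurableT_comp => //.
apply: measurable_funB.
  exact: (measurableT_comp mf measurable_fst).
exact: (measurableT_comp mf measurable_snd).
Qed.

Lemma gagliardo_integrand_ge0 s f (z : Rn R n * Rn R n) :
  0 <= `|f z.1 - f z.2| ^+ 2 * frac_kernel s z.1 z.2.
Proof. by rewrite mulr_ge0 ?exprn_ge0// frac_kernel_ge0. Qed.

Definition superlevel f l : set (Rn R n) := unitB `&` [set x | l <= `|f x|].

Lemma measurable_superlevel f l : measurable_fun setT f ->
  measurable (superlevel f l).
Proof.
move=> mf; apply: measurableI; first exact: measurable_unitB.
rewrite -[X in measurable X]setTI.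
have mnf : measurable_fun setT (fun x => `|f x|) by exact: measurableT_comp.
exact: (measurable_fun_ler (measurable_cst l) mnf).
Qed.

(** The diagonal is excluded, because the kernel is read as 0 there. *)
Lemma frac_kernel_ge s x y h : 0 < n%:R + 2 * s -> 0 < edist x y -> edist x y <= h ->
  h `^ (- (n%:R + 2 * s)) <= frac_kernel s x y.
Proof.
move=> a0 xy0 xyh; rewrite powRN /frac_kernel.
have h0 : 0 < h := lt_le_trans xy0 xyh.
rewrite lef_pV2 ?posrE ?powR_gt0//.
by rewrite ge0_ler_powR ?nnegrE ?(ltW a0) ?(ltW xy0) ?(ltW h0).
Qed.

Lemma neq_edist_gt0 f x y : f x != f y -> 0 < edist x y.
Proof.
move=> fxy; rewrite lt_neqAle sqrtr_ge0 andbT eq_sym.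
by apply: contra fxy => /eqP/edist_eq0 ->.
Qed.

(** The unit ball contains a cube of volume [cube_vol rho] within distance
    [2 rho] of any [x] where [|f x| >= l + t]; at least half of that cube lies
    where [|f| < l], and there [f] differs from [f x] by at least [t]. *)
Lemma superlevel_decay s f l t rho : (1 <= n)%N -> 0 < s ->
  measurable_fun setT f -> 0 < t -> 0 < rho < 1 ->
  (mu (superlevel f l) <= (cube_vol rho / 2)%:E)%E ->
  ((t ^+ 2 * (2 * rho) `^ (- (n%:R + 2 * s)) * (cube_vol rho / 2))%:E *
    mu (superlevel f (l + t)%R) <= gagliardo s f)%E.
Proof.
move=> n1 s0 mf t0 rho01 muA.
have /andP[rho0 _] := rho01.
have a0 : 0 < n%:R + 2 * s by rewrite ltr_wpDl ?ler0n ?mulr_gt0.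
set A := superlevel f l in muA *; set A' := superlevel f (l + t).
have mA : measurable A by exact: measurable_superlevel.
have mA' : measurable A' by exact: measurable_superlevel.
have mB := @measurable_unitB R n.
set c := t ^+ 2 * _ `^ _.
have c0 : 0 <= c by rewrite mulr_ge0 ?powR_ge0// exprn_ge0// ltW.
(* Pairs that realize the jump: [f] is high at [x], low at [y]. *)
pose S : set (Rn R n * Rn R n) :=
  (A' `*` (unitB `\` A)) `&` [set z | edist z.1 z.2 <= 2 * rho].
have mS : measurable S.
  apply: measurableI.
    by apply: measurableX => //; exact: measurableD.
  rewrite -[X in measurable X]setTI.
  exact: (measurable_fun_ler (measurable_edist) (measurable_cst _)).
have SQ : S `<=` domQ by move=> [x y] [[[xB _] _] _] [/= + _]; exact.
have mg := measurable_gagliardo_integrand s mf.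
have cS : (c%:E * (mu \x mu) S <= gagliardo s f)%E.
  rewrite -integral_cst//.
  apply: (@le_trans _ _ (\int[(mu \x mu)%E]_(z in S)
     (`|f z.1 - f z.2| ^+ 2 * frac_kernel s z.1 z.2)%:E)%E).
    apply: ge0_le_integral => //.
      by apply/measurable_EFinP; exact: measurable_funTS.
    move=> [x y] [[[xB /= fx] [yB yA]] /= xy]; rewrite lee_fin.
    have fy : `|f y| < l by rewrite ltNge; apply/negP => ?; exact: yA.
    have tf : t <= `|f x - f y|.
      by apply: le_trans (lerB_dist _ _); lra.
    rewrite ler_pM ?powR_ge0 ?exprn_ge0 ?(ltW t0)//.
      by rewrite lerXn2r ?nnegrE// ltW.
    apply: frac_kernel_ge => //; apply: (@neq_edist_gt0 f).
    by rewrite -subr_eq0 -normr_gt0; exact: lt_le_trans tf.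
  apply: ge0_subset_integral => //.
  - exact: measurable_domQ.
  - by apply/measurable_EFinP; exact: measurable_funTS.
  - by move=> z _; rewrite lee_fin gagliardo_integrand_ge0.
apply: le_trans cS; rewrite EFinM -muleA.
apply: lee_wpmul2l; first by rewrite lee_fin.
rewrite -integral_cst// /product_measure1.
apply: (@le_trans _ _ (\int[mu]_(x in A') (mu \o xsection S) x)%E).
  apply: ge0_le_integral => //.
  - move=> x _; rewrite lee_fin divr_ge0// exprn_ge0// mulrn_wge0// divr_ge0//.
    exact: ltW.
  - by apply: measurable_funTS; exact: measurable_fun_xsection.
  move=> x [xB fx] /=.
  have [D [mD DB Dx muD]] := unitB_thick n1 rho01 xB.
  apply: (@le_trans _ _ (mu (D `\` A))); last first.
    rewrite le_measure ?inE//.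
    - exact: measurableD.
    - exact: measurable_xsection.
    - move=> y [Dy Ay]; apply/xsectionP; split; last exact: Dx.
      by split => //; split => //; exact: DB.
  have : (mu D <= mu A + mu (D `\` A))%E.
    rewrite (measureDI mu mD mA) addeC leeD//.
    by rewrite le_measure ?inE//; exact: measurableI.
  rewrite muD => H.
  have : ((cube_vol rho)%:E <= (cube_vol rho / 2)%:E + mu (D `\` A))%E.
    by apply: (le_trans H); rewrite leeD2r.
  rewrite -leeBlDl// -EFinB; apply: le_trans.
  by rewrite lee_fin; lra.
have mS1 : measurable_fun setT (mu \o xsection S).
  exact: measurable_fun_xsection.
exact: (ge0_subset_integral mu mA' measurableT mS1).
Qed.

Lemma integrable_unitB_cst (r : R) : mu.-integrable unitB (EFin \o (fun=> r)).
Proof.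
apply/integrableP; split; first exact: measurable_cst.
rewrite (_ : (fun _ => _) = fun=> `|r|%:E)//.
rewrite integral_cst//; last exact: measurable_unitB.
by rewrite lte_mul_pinfty ?lee_fin// lebesgueRn_unitB_lty.
Qed.

Lemma integrable_of_sqr f : measurable_fun setT f ->
  (\int[mu]_(x in unitB) (`|f x| ^+ 2)%:E < +oo)%E ->
  mu.-integrable unitB (EFin \o (fun x => f x ^+ 2)) /\
  mu.-integrable unitB (EFin \o f).
Proof.
move=> mf f2.
have mB := @measurable_unitB R n.
have If2 : mu.-integrable unitB (EFin \o (fun x => f x ^+ 2)).
  apply/integrableP; split.
    by apply/measurable_EFinP/measurable_funX; exact: measurable_funTS.
  by under eq_integral do rewrite /= normrX.
split => //.
have I1 := integrable_unitB_cst 1.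
apply: (le_integrable _ _ _ (integrableD _ If2 I1)) => //.
  by apply/measurable_EFinP; exact: measurable_funTS.
move=> x _ /=; rewrite lee_fin [X in _ <= X]ger0_norm ?addr_ge0 ?sqr_ge0//.
have := sqr_ge0 (`|f x| - 1); rewrite -[f x ^+ 2]real_normK ?num_real//.
have := normr_ge0 (f x); nra.
Qed.

(** The mean, here zero, minimizes the quadratic deviation. *)
Lemma sqr_deviation_ge f c : measurable_fun setT f ->
  (\int[mu]_(x in unitB) (`|f x| ^+ 2)%:E < +oo)%E ->
  \int[mu]_(x in unitB) f x = 0 ->
  (\int[mu]_(x in unitB) (`|f x| ^+ 2)%:E <=
   \int[mu]_(x in unitB) (`|c - f x| ^+ 2)%:E)%E.
Proof.
move=> mf f2 f0.
have [If2 If] := integrable_of_sqr mf f2.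
have mB := @measurable_unitB R n.
have I1 := integrable_unitB_cst.
have Icf : mu.-integrable unitB (EFin \o (fun x => 2 * c * f x)).
  exact: (integrableZl _ (2 * c) If).
have Ig : mu.-integrable unitB (EFin \o (fun x => f x ^+ 2 - 2 * c * f x)).
  exact: (integrableB _ If2 Icf).
have -> : (\int[mu]_(x in unitB) (`|f x| ^+ 2)%:E =
    (\int[mu]_(x in unitB) (f x ^+ 2 - 2 * c * f x))%:E)%E.
  rewrite RintegralB// RintegralZl// f0 mulr0 subr0 fineK; last first.
    exact: integrable_fin_num.
  by apply: eq_integral => x _; rewrite real_normK ?num_real.
rewrite fineK; last exact: integrable_fin_num.
rewrite [leRHS](_ : _ = \int[mu]_(x in unitB)
    ((EFin \o (fun x => (f x ^+ 2 - 2 * c * f x)%R)) x +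
     (EFin \o (fun=> (c ^+ 2)%R)) x))%E; last first.
  apply: eq_integral => x _ /=; rewrite real_normK ?num_real// -EFinD.
  by congr EFin; ring.
rewrite integralD//.
rewrite leeDl// integral_ge0// => x _.
by rewrite lee_fin sqr_ge0.
Qed.

(** Integrate [sqr_deviation_ge] over [c = f x], [x] in the ball.  Two points of
    the ball are at distance at most 2, so the kernel is at least
    [2^(-(n+2s))] there. *)
Lemma fractional_poincare s f : 0 < s -> measurable_fun setT f ->
  (\int[mu]_(x in unitB) (`|f x| ^+ 2)%:E < +oo)%E ->
  \int[mu]_(x in unitB) f x = 0 ->
  (mu unitB * \int[mu]_(x in unitB) (`|f x| ^+ 2)%:E <=
   (2 `^ (n%:R + 2 * s))%:E * gagliardo s f)%E.
Proof.
move=> s0 mf f2 f0.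
have a0 : 0 < n%:R + 2 * s by rewrite ltr_wpDl ?ler0n ?mulr_gt0.
have mB := @measurable_unitB R n.
pose dev := fun z : Rn R n * Rn R n => (`|f z.1 - f z.2| ^+ 2)%:E.
pose BB : set (Rn R n * Rn R n) := unitB `*` unitB.
have mBB : measurable BB by exact: measurableX.
have mdev : measurable_fun setT dev.
  apply/measurable_EFinP/measurable_funX; apply: measurableT_comp => //.
  apply: measurable_funB.
    exact: (measurableT_comp mf measurable_fst).
  exact: (measurableT_comp mf measurable_snd).
have BQ : BB `<=` domQ by move=> [x y] [xB _] [/= + _]; exact.
have mg := measurable_gagliardo_integrand s mf.
apply: (@le_trans _ _ (\int[(mu \x mu)%E]_(z in BB) dev z)%E).
  have mdevB : measurable_fun setT (dev \_ BB).
    exact/(measurable_restrictT _ _).1/measurable_funTS.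
  have devB0 z : (0 <= (dev \_ BB) z)%E.
    by rewrite erestrict_ge0// => ? _; rewrite lee_fin exprn_ge0.
  have mF := measurable_fun_fubini_tonelli_F (m2 := mu) _ mdevB devB0.
  have F0 x : (0 <= fubini_F mu (dev \_ BB) x)%E by exact: integral_ge0.
  have FE x : unitB x -> (\int[mu]_(y in unitB) (`|f y| ^+ 2)%:E <=
      fubini_F mu (dev \_ BB) x)%E.
    move=> xB; rewrite /fubini_F (_ : (\int[mu]_y (dev \_ BB) (x, y) =
       \int[mu]_(y in unitB) (`|f x - f y| ^+ 2)%:E)%E).
      exact: sqr_deviation_ge.
    rewrite [RHS]integral_mkcond; apply: eq_integral => y _.
    by rewrite !patchE in_setX/= mem_set.
  have f20 : (0 <= \int[mu]_(y in unitB) (`|f y| ^+ 2)%:E)%E.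
    by apply: integral_ge0 => y _; rewrite lee_fin exprn_ge0.
  rewrite [leRHS]integral_mkcond (fubini_tonelli1 _ mdevB devB0).
  rewrite muleC -(integral_cst mu mB).
  apply: (@le_trans _ _ (\int[mu]_(x in unitB) fubini_F mu (dev \_ BB) x)%E).
    exact: (ge0_le_integral mu mB (fun x _ => f20) (measurable_cst _)
      (measurable_funTS mF) FE).
  exact: (ge0_subset_integral mu mB measurableT mF).
rewrite /gagliardo -ge0_integralZl_EFin ?powR_ge0//; last 3 first.
- exact: measurable_domQ.
- by move=> z _; rewrite lee_fin gagliardo_integrand_ge0.
- by apply/measurable_EFinP; exact: measurable_funTS.
apply: (@le_trans _ _ (\int[(mu \x mu)%E]_(z in BB) ((2 `^ (n%:R + 2 * s))%:E *
     (`|f z.1 - f z.2| ^+ 2 * frac_kernel s z.1 z.2)%:E))%E).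
  apply: ge0_le_integral => //.
  - by move=> z _; rewrite lee_fin exprn_ge0.
  - exact: measurable_funTS.
  - by apply: measurable_funeM; apply/measurable_EFinP; exact: measurable_funTS.
  move=> [x y] [/= xB yB]; rewrite /dev/= -EFinM lee_fin.
  have [->|fxy] := eqVneq (f x) (f y).
    by rewrite subrr normr0 expr0n/= mul0r mulr0.
  rewrite mulrCA ler_peMr ?exprn_ge0//.
  have := frac_kernel_ge a0 (neq_edist_gt0 fxy) (edist_le2 xB yB).
  by rewrite powRN -ler_pdivrMl ?powR_gt0// mulr1.
apply: ge0_subset_integral => //.
- exact: measurable_domQ.
- by apply: measurable_funeM; apply/measurable_EFinP; exact: measurable_funTS.
- by move=> z _; rewrite mule_ge0 ?lee_fin ?powR_ge0// gagliardo_integrand_ge0.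
Qed.

End energy.

(** * The subcritical fractional Sobolev inequality *)

(** [b = 2^(-tau)] for any [tau > p / n] with [tau (n - 2s) <= 2]; the two
    requirements on [tau] are compatible exactly below the critical exponent
    [2n / (n - 2s)], and always when [n <= 2s]. *)
Lemma subcritical_ratio (R : realType) (n : nat) (s p : R) :
  (1 <= n)%N -> 0 < s -> 0 < p ->
  (2 * s < n%:R -> p < 2 * n%:R / (n%:R - 2 * s)) ->
  exists b : R, [/\ 0 < b < 1, 2 `^ p * b ^+ n < 1 & b `^ (2 * s) <= 4 * b ^+ n].
Proof.
move=> n1 s0 p0 sub.
have n0 : 0 < n%:R :> R by rewrite ltr0n.
have [tau [tau0 ptau tau2]] : exists tau : R,
    [/\ 0 < tau, p < tau * n%:R & tau * (n%:R - 2 * s) <= 2].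
  have [/[dup] sn /sub psub|ns] := ltP (2 * s) n%:R.
    exists (2 / (n%:R - 2 * s)); split.
    - by rewrite divr_gt0// subr_gt0.
    - by rewrite mulrAC.
    - by rewrite divfK// gt_eqF// subr_gt0.
  exists (p / n%:R + 1); split.
  - by rewrite addr_gt0// divr_gt0.
  - by rewrite mulrDl divfK ?gt_eqF// mul1r ltrDl.
  - apply: (@le_trans _ _ 0) => //; apply: mulr_ge0_le0; last by rewrite subr_le0.
    by rewrite addr_ge0// divr_ge0// ltW.
have two0 : (2 : R) != 0 by rewrite pnatr_eq0.
exists (2 `^ (- tau)).
have bn : (2 `^ (- tau)) ^+ n = 2 `^ (- (tau * n%:R)) :> R.
  by rewrite -powR_mulrn ?powR_ge0// -powRrM mulNr.
split.
- by rewrite powR_gt0//= powRN invf_lt1 ?powR_gt0// powR_gt1// ltr1n.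
- rewrite bn -powRD ?two0 ?implybT// -opprB powRN invf_lt1 ?powR_gt0//.
  by rewrite powR_gt1 ?ltr1n// subr_gt0.
- have -> : (4 : R) = 2 `^ 2%:R by rewrite powR_mulrn// expr2; ring.
  rewrite bn -powRrM -powRD ?two0 ?implybT// ler_powR ?ler1n//.
  move: tau2; rewrite mulrBr; lra.
Qed.

Section sobolev.
Context {R : realType} {n : nat}.
Notation mu := (lebesgueRn R n).
Implicit Types (x y : Rn R n) (f : Rn R n -> R) (s rho l t p : R).

Lemma cube_vol_gt0 rho : (1 <= n)%N -> 0 < rho -> 0 < cube_vol (n := n) rho.
Proof. by move=> n1 rho0; rewrite exprn_gt0// pmulrn_lgt0// divr_gt0// ltr0n. Qed.

Definition volB : R := fine (mu unitB).

Lemma lebesgueRn_unitB : mu unitB = volB%:E.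
Proof. by rewrite fineK// ge0_fin_numE// lebesgueRn_unitB_lty. Qed.

Lemma volB_gt0 : (1 <= n)%N -> 0 < volB.
Proof.
move=> n1; pose x0 : Rn R n := [tuple of nseq n (0 : R)].
have x0B : unitB x0.
  apply/enorm_lt1P; rewrite big1// => i _.
  by rewrite /coord tnth_nseq expr0n.
have h : 0 < (2^-1 : R) < 1 by apply/andP; split; lra.
have [D [mD DB _ muD]] := unitB_thick n1 h x0B.
rewrite -lte_fin -lebesgueRn_unitB.
apply: (@lt_le_trans _ _ (mu D)).
  by rewrite muD lte_fin cube_vol_gt0// invr_gt0.
by rewrite le_measure ?inE//; exact: measurable_unitB.
Qed.

Lemma superlevel_chebyshev f l : measurable_fun setT f -> 0 <= l ->
  ((l ^+ 2)%:E * mu (superlevel f l) <= \int[mu]_(x in unitB) (`|f x| ^+ 2)%:E)%E.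
Proof.
move=> mf l0; have mA := measurable_superlevel l mf.
have mf2 : measurable_fun setT (fun x => (`|f x| ^+ 2)%:E).
  by apply/measurable_EFinP/measurable_funX; exact: measurableT_comp.
have f20 x : (0 <= (`|f x| ^+ 2)%:E)%E by rewrite lee_fin exprn_ge0.
have l20 x : superlevel f l x -> (0 <= cst (l ^+ 2)%:E x)%E.
  by rewrite lee_fin exprn_ge0.
have lf x : superlevel f l x -> (cst (l ^+ 2)%:E x <= (`|f x| ^+ 2)%:E)%E.
  by move=> [_ fx]; rewrite lee_fin lerXn2r ?nnegrE.
have mB := @measurable_unitB R n.
rewrite -(integral_cst mu mA).
apply: (@le_trans _ _ (\int[mu]_(x in superlevel f l) (`|f x| ^+ 2)%:E)%E).
  exact: (ge0_le_integral mu mA l20 (measurable_cst _) (measurable_funTS mf2) lf).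
apply: (ge0_subset_integral mu mA mB (measurable_funTS mf2) (fun x _ => f20 x)).
by move=> x [].
Qed.

Lemma superlevel_fin f l : measurable_fun setT f ->
  exists2 m, mu (superlevel f l) = m%:E & 0 <= m.
Proof.
move=> mf; exists (fine (mu (superlevel f l))); last exact: fine_ge0.
rewrite fineK// ge0_fin_numE//.
apply: le_lt_trans (@lebesgueRn_unitB_lty R n).
rewrite le_measure ?inE//; last by move=> x [].
  exact: measurable_superlevel.
exact: measurable_unitB.
Qed.

(** Apply [superlevel_decay] with [l = t = L 2^k] and [rho = b^(k+1)], the scale
    for which the bound on the [k]-th level set is half the volume of a cube.
    The bound that results for the next level set is multiplied by
    [b^(2s) / 4 <= b^n] when [k] increases by one. *)
Lemma superlevel_geometric s b : (1 <= n)%N -> 0 < s ->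
  0 < b < 1 -> b `^ (2 * s) <= 4 * b ^+ n ->
  exists L, 0 < L /\ forall f, measurable_fun setT f ->
    (\int[mu]_(x in unitB) (`|f x| ^+ 2)%:E < +oo)%E ->
    \int[mu]_(x in unitB) f x = 0 -> (gagliardo s f <= 1)%E ->
    forall k, (mu (superlevel f (L * 2 ^+ k)) <=
               (cube_vol (n := n) b / 2 * (b ^+ n) ^+ k)%:E)%E.
Proof.
move=> n1 s0 b01 bs; have /andP[b0 b1] := b01.
pose a := n%:R + 2 * s.
pose a0 := cube_vol (n := n) b / 2.
pose M := volB.
have M0 : 0 < M by exact: volB_gt0.
have a00 : 0 < a0 by rewrite divr_gt0// cube_vol_gt0.
have bn0 : 0 < b ^+ n by rewrite exprn_gt0.
(* [K1 <= L^2] starts the induction, [K2 <= L^2] closes it. *)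
pose K1 := 2 `^ a / (M * a0).
pose K2 := 2 `^ a * b `^ a / (a0 ^+ 2 * b ^+ n).
have K10 : 0 <= K1 by rewrite divr_ge0 ?powR_ge0// mulr_ge0// ltW.
have K20 : 0 <= K2.
  by rewrite divr_ge0// mulr_ge0 ?powR_ge0// ?exprn_ge0// ltW.
pose L := 1 + K1 + K2.
have L1 : 1 <= L by rewrite /L; lra.
have LL : L <= L ^+ 2 by rewrite expr2 ler_peMl//; lra.
have LK1 : K1 <= L ^+ 2 by apply: le_trans LL; rewrite /L; lra.
have LK2 : K2 <= L ^+ 2 by apply: le_trans LL; rewrite /L; lra.
exists L; split; first by lra.
move=> f mf f2 f0 Ef; elim => [|k ih].
  rewrite !expr0 !mulr1.
  have := fractional_poincare s0 mf f2 f0.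
  have := superlevel_chebyshev mf (le_trans ler01 L1).
  have [m -> m0] := superlevel_fin L mf.
  have [F -> F0] : exists2 F : R,
      (\int[mu]_(x in unitB) (`|f x| ^+ 2)%:E = F%:E)%E & 0 <= F.
    have F0 : (0 <= \int[mu]_(x in unitB) (`|f x| ^+ 2)%:E)%E.
      by apply: integral_ge0 => x _; rewrite lee_fin exprn_ge0.
    exists (fine (\int[mu]_(x in unitB) (`|f x| ^+ 2)%:E)%E); last exact: fine_ge0.
    by rewrite fineK// ge0_fin_numE.
  rewrite lebesgueRn_unitB -!EFinM !lee_fin => h1 h2.
  have {}h2 : M * F <= 2 `^ a.
    rewrite -lee_fin; apply: (le_trans h2).
    by rewrite -[leRHS]mule1 lee_wpmul2l// lee_fin powR_ge0.
  move: LK1; rewrite (ler_pdivrMr _ _ (mulr_gt0 M0 a00)) => h3.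
  have ML0 : 0 < M * L ^+ 2 by apply: mulr_gt0 => //; apply: exprn_gt0; lra.
  rewrite -(ler_pM2l ML0) -/a0.
  apply: (@le_trans _ _ (M * F)); first by rewrite -mulrA ler_pM2l.
  by apply: (le_trans h2); apply: (le_trans h3); rewrite le_eqVlt mulrCA mulrA eqxx.
have t0 : 0 < L * 2 ^+ k by rewrite mulr_gt0 ?exprn_gt0//; lra.
have rho01 : 0 < b ^+ k.+1 < 1 by rewrite exprn_gt0// exprn_ilt1// ltW.
(* The induction hypothesis bounds the level set by half a cube at this scale. *)
have volE : cube_vol (n := n) (b ^+ k.+1) / 2 = a0 * (b ^+ n) ^+ k.
  have sideE : b ^+ k.+1 / n%:R *+ 2 = (b / n%:R *+ 2) * b ^+ k.
    by rewrite exprS mulrnAl mulrAC.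
  by rewrite /a0 /cube_vol sideE exprMn exprAC mulrAC.
have := @superlevel_decay R n s f (L * 2 ^+ k) (L * 2 ^+ k) (b ^+ k.+1) n1 s0 mf t0 rho01.
rewrite volE => /(_ ih) H.
have -> : L * 2 ^+ k.+1 = L * 2 ^+ k + L * 2 ^+ k by rewrite exprS; ring.
move: H; have [m -> m0] := superlevel_fin (L * 2 ^+ k + L * 2 ^+ k) mf.
move=> /le_trans/(_ Ef); rewrite -EFinM !lee_fin -/a -/a0 => H.
set T := L * 2 ^+ k in H *; set W := (2 * b ^+ k.+1) `^ a.
have W0 : 0 < W by rewrite powR_gt0// mulr_gt0//; case/andP: rho01.
have bk0 : 0 < (b ^+ n) ^+ k by rewrite exprn_gt0.
have {}H : T ^+ 2 * (a0 * (b ^+ n) ^+ k) * m <= W.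
  move: H; rewrite powRN -/W.
  have -> : T ^+ 2 / W * (a0 * (b ^+ n) ^+ k) * m =
     (T ^+ 2 * (a0 * (b ^+ n) ^+ k) * m) / W by ring.
  by rewrite ler_pdivrMr// mul1r.
have WT : W <= T ^+ 2 * (a0 * (b ^+ n) ^+ k) * (a0 * (b ^+ n) ^+ k.+1).
  have ba : b `^ a <= 4 * (b ^+ n) ^+ 2.
    rewrite /a powRD; last by rewrite (gt_eqF b0) implybT.
    rewrite powR_mulrn ?(ltW b0)// expr2 mulrCA.
    by rewrite ler_pM2l.
  have -> : W = 2 `^ a * b `^ a * (b `^ a) ^+ k.
    rewrite /W powRM ?exprn_ge0 ?(ltW b0)//.
    by rewrite powRX// exprS mulrA.
  have D0 : 0 < a0 ^+ 2 * b ^+ n by apply: mulr_gt0 => //; exact: exprn_gt0.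
  move: LK2; rewrite (ler_pdivrMr _ _ D0) => h2.
  apply: (@le_trans _ _ (L ^+ 2 * (a0 ^+ 2 * b ^+ n) * (4 * (b ^+ n) ^+ 2) ^+ k)).
    rewrite ler_pM ?mulr_ge0 ?powR_ge0 ?exprn_ge0 ?powR_ge0//.
    by rewrite lerXn2r// ?nnegrE ?powR_ge0// mulr_ge0// exprn_ge0// ltW.
  rewrite le_eqVlt; apply/orP; left; apply/eqP.
  have -> : 4 * (b ^+ n) ^+ 2 = (2 * b ^+ n) ^+ 2 by ring.
  rewrite exprAC (exprMn k (2 : R) (b ^+ n)) (exprS _ k) /T.
  by move: (2 ^+ k) ((b ^+ n) ^+ k) => X Y; ring.
rewrite -(@ler_pM2l _ (T ^+ 2 * (a0 * (b ^+ n) ^+ k))).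
  exact: le_trans H WT.
by apply: mulr_gt0; [exact: exprn_gt0|exact: mulr_gt0].
Qed.

(** Below the level [L] the integrand is at most [L^p]; above it, the layer
    between [L 2^k] and [L 2^(k+1)] contributes at most a multiple of
    [(2^p b^n)^k]. *)
Lemma subcritical_sobolev s p : (1 <= n)%N -> 0 < s -> 0 < p ->
  (2 * s < n%:R -> p < 2 * n%:R / (n%:R - 2 * s)) ->
  exists C, 0 <= C /\ forall f, measurable_fun setT f ->
    (\int[mu]_(x in unitB) (`|f x| ^+ 2)%:E < +oo)%E ->
    \int[mu]_(x in unitB) f x = 0 -> (gagliardo s f <= 1)%E ->
    (\int[mu]_(x in unitB) (`|f x| `^ p)%:E <= C%:E)%E.
Proof.
move=> n1 s0 p0 sub.
have [b [b01 pb bs]] := subcritical_ratio n1 s0 p0 sub.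
have [L [L0 geoL]] := superlevel_geometric n1 s0 b01 bs.
have /andP[b0 _] := b01.
set a0 := cube_vol b / 2 in geoL.
have a00 : 0 < a0 by apply: divr_gt0 => //; exact: cube_vol_gt0.
pose r := 2 `^ p * b ^+ n.
have r01 : 0 < r < 1 by rewrite pb andbT mulr_gt0 ?powR_gt0 ?exprn_gt0.
have r1 : 0 < 1 - r by rewrite subr_gt0.
pose C1 := L `^ p * volB.
pose C2 := L `^ p * 2 `^ p * a0.
have C10 : 0 <= C1 by rewrite mulr_ge0 ?powR_ge0// ltW// volB_gt0.
have C20 : 0 <= C2 by apply: mulr_ge0; [apply: mulr_ge0; exact: powR_ge0|exact: ltW].
exists (C1 + C2 / (1 - r)); split.
  by apply: addr_ge0 => //; apply: divr_ge0 => //; exact: ltW.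
move=> f mf f2 f0 Ef; have {}geoL := geoL f mf f2 f0 Ef.
have mB := @measurable_unitB R n.
set g := fun x => (`|f x| `^ p)%:E.
have g0 x : (0 <= g x)%E by rewrite lee_fin powR_ge0.
have mg : measurable_fun setT g.
  apply/measurable_EFinP; apply: (measurableT_comp (measurable_powR _)).
  exact: measurableT_comp.
pose A := superlevel f L; have mA : measurable A by exact: measurable_superlevel.
have AB : A `<=` unitB by move=> x [].
have mBA : measurable (unitB `\` A) by exact: measurableD.
have -> : (\int[mu]_(x in unitB) g x = \int[mu]_(x in unitB `\` A) g x +
    \int[mu]_(x in A) g x)%E.
  rewrite -(ge0_integral_setU mu mBA mA).
  - by rewrite setDKU.
  - exact: measurable_funTS.
  - by move=> x _; exact: g0.
  - by apply/disj_setPS => x [[]].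
rewrite EFinD; apply: leeD.
  have c0 x : (unitB `\` A) x -> (0 <= cst (L `^ p)%:E x :> \bar R)%E.
    by move=> _; rewrite lee_fin powR_ge0.
  have gc x : (unitB `\` A) x -> (g x <= cst (L `^ p)%:E x)%E.
    move=> [xB xA]; rewrite lee_fin ge0_ler_powR ?nnegrE ?(ltW p0) ?(ltW L0)//.
    by apply/ltW; rewrite ltNge; apply/negP => ?; exact: xA.
  apply: le_trans (ge0_le_integral mu mBA (fun x _ => g0 x)
    (measurable_funTS mg) (measurable_cst _) gc) _.
  rewrite (integral_cst mu mBA) /C1 EFinM -lebesgueRn_unitB.
  apply: lee_wpmul2l; first by rewrite lee_fin powR_ge0.
  by rewrite le_measure ?inE.
apply: (ge0_integral_layers (F := fun k => superlevel f (L * 2 ^+ k))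
  (a := fun k => (L * 2 ^+ k.+1) `^ p) mA (measurable_funTS mg)
  (fun x _ => g0 x) (fun k => measurable_superlevel _ mf)
  (fun k => powR_ge0 _ _) _ C20 r01).
- move=> x [xB xL] _.
  have fL : 1 <= `|f x| / L by rewrite ler_pdivlMr// mul1r.
  have [k /andP[kx xk]] := dyadic_bracket fL.
  exists k; first by split => //=; rewrite mulrC -ler_pdivlMr.
  rewrite lee_fin ge0_ler_powR ?nnegrE ?(ltW p0)//.
    by rewrite mulr_ge0 ?exprn_ge0// ltW.
  by rewrite mulrC -ler_pdivrMr// ltW.
move=> k; apply: (@le_trans _ _ (((L * 2 ^+ k.+1) `^ p)%:E *
    (a0 * (b ^+ n) ^+ k)%:E)%E).
  by apply: lee_wpmul2l; [rewrite lee_fin powR_ge0|exact: geoL].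
rewrite -EFinM lee_fin powRM ?exprn_ge0 ?(ltW L0)// powRX// exprS.
rewrite /r exprMn /C2 le_eqVlt; apply/orP; left; apply/eqP.
by move: (2 `^ p) ((2 `^ p) ^+ k) ((b ^+ n) ^+ k) => X Y Z; ring.
Qed.

End sobolev.

(** * Pointwise bounds on the reaction term *)

Section real_inequalities.
Context {R : realType}.
Implicit Types a b x y r : R.

Lemma subr1X_le (t : R) N : 0 <= t <= 1 -> 1 - t ^+ N <= N%:R * (1 - t).
Proof.
move=> /andP[t0 t1]; elim: N => [|N ih]; first by rewrite expr0 subrr mul0r.
rewrite exprS -natr1 mulrDl mul1r.
have tN : t ^+ N <= 1 by rewrite exprn_ile1.
have tN0 : 0 <= t ^+ N by rewrite exprn_ge0.
nra.
Qed.

(** For [t = b / a] in [[0, 1]], Bernoulli's inequality gives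
    [1 - t^r <= 1 - t^N <= N (1 - t)]. *)
Lemma powR_sub_le a b r N : 0 <= b <= a -> 1 < r -> r <= N%:R ->
  a `^ r - b `^ r <= N%:R * a `^ (r - 1) * (a - b).
Proof.
move=> /andP[b0 ba] r1 rN.
have N1 : 1 < N%:R :> R := lt_le_trans r1 rN.
have r0 : 0 < r := lt_trans ltr01 r1.
have [a0|a0] := eqVneq a 0.
  have -> : b = 0 by apply/eqP; rewrite eq_le b0 andbT -a0.
  by rewrite a0 !subrr mulr0.
have {}a0 : 0 < a by rewrite lt_neqAle eq_sym a0 (le_trans b0).
pose t := b / a.
have bE : b = a * t by rewrite /t mulrCA divff ?gt_eqF// mulr1.
have t0 : 0 <= t by rewrite divr_ge0// ltW.
have t1 : t <= 1 by rewrite ler_pdivrMr// mul1r.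
have -> : a - b = a * (1 - t) by rewrite bE; ring.
rewrite bE powRM// ?(ltW a0)//.
have -> : a `^ r - a `^ r * t `^ r = a `^ r * (1 - t `^ r) by ring.
have -> : N%:R * a `^ (r - 1) * (a * (1 - t)) = a `^ r * (N%:R * (1 - t)).
  by rewrite -(mulr_powRB1 (ltW a0) r0); ring.
rewrite ler_pM2l ?powR_gt0//.
have [->|tn0] := eqVneq t 0.
  by rewrite powR0 ?gt_eqF// !subr0 mulr1 ltW.
have t0' : 0 < t by rewrite lt_neqAle eq_sym tn0.
apply: le_trans (subr1X_le N (introT andP (conj t0 t1))).
by rewrite lerD2l lerN2 -powR_mulrn// ger_powR// t0'.
Qed.

Lemma powR_sub_mul_le a b r N : 0 <= a -> 0 <= b -> 1 < r -> r <= N%:R ->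
  (a `^ r - b `^ r) * (a - b) <=
    N%:R * (a `^ (r - 1) + b `^ (r - 1)) * (a - b) ^+ 2.
Proof.
wlog ba : a b / b <= a.
  move=> H a0 b0 r1 rN; have [/H|/ltW/H] := leP b a; first exact.
  move=> /(_ b0 a0 r1 rN); rewrite (addrC (b `^ (r - 1))) -(sqrrN (b - a)) opprB.
  by rewrite -mulrNN !opprB.
move=> a0 b0 r1 rN.
have ab0 : 0 <= a - b by rewrite subr_ge0.
have N0 : 0 <= N%:R :> R by [].
have h := powR_sub_le (introT andP (conj b0 ba)) r1 rN.
apply: (le_trans (ler_wpM2r ab0 h)).
rewrite expr2 mulrA ler_wpM2r// ler_wpM2r// ler_wpM2l//.
by rewrite lerDl powR_ge0.
Qed.

(** The left-hand side is at most [x^r] if [y^2 <= x], and at most [y^(2r)]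
    otherwise.  This elementary splitting plays the part of Hoelder's inequality
    with exponents [r / (r - 1)] and [r]. *)
Lemma powR_mul_sqr_le x y r : 0 <= x -> 0 <= y -> 1 < r ->
  x `^ (r - 1) * y ^+ 2 <= x `^ r + y `^ (2 * r).
Proof.
move=> x0 y0 r1; have r0 : 0 < r := lt_trans ltr01 r1.
have yE : y `^ (2 * r) = (y ^+ 2) `^ r by rewrite powRrM powR_mulrn.
have [yx|/ltW xy] := leP (y ^+ 2) x.
  apply: (@le_trans _ _ (x `^ r)); last by rewrite lerDl powR_ge0.
  by rewrite -(mulr_powRB1 x0 r0) mulrC ler_wpM2r// powR_ge0.
apply: (@le_trans _ _ (y `^ (2 * r))); last by rewrite lerDr powR_ge0.
rewrite yE -(mulr_powRB1 (sqr_ge0 y) r0) mulrC ler_wpM2l ?sqr_ge0//.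
by rewrite ge0_ler_powR ?nnegrE ?sqr_ge0// subr_ge0 ltW.
Qed.

(** The reaction term in the form used for [u - m = sqrt E * w]: quadratic in
    [a - b], hence proportional to the energy [c], with a factor that is
    integrable uniformly in the solution. *)
Lemma reaction_le a b w c r N : 0 <= a -> 0 <= b -> 1 < r -> r <= N%:R ->
  0 <= c -> (a - b) ^+ 2 = c * w ^+ 2 ->
  (a `^ r - b `^ r) * (a - b) <=
    N%:R * c * (a `^ r + b `^ r + 2 * `|w| `^ (2 * r)).
Proof.
move=> a0 b0 r1 rN c0 abw; apply: (le_trans (powR_sub_mul_le a0 b0 r1 rN)).
rewrite abw -[w ^+ 2]real_normK ?num_real// -!mulrA ler_wpM2l//.
have ha := powR_mul_sqr_le a0 (normr_ge0 w) r1.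
have hb := powR_mul_sqr_le b0 (normr_ge0 w) r1.
rewrite mulrCA ler_wpM2l// mulrDl; lra.
Qed.

(** Beyond [2^(1/(r-1))], the power [x^(r-1)] exceeds 2. *)
Lemma le_powR_half x r : 0 <= x -> 1 < r ->
  x <= 2 `^ (r - 1)^-1 + x `^ r / 2.
Proof.
move=> x0 r1; have r0 : 0 < r := lt_trans ltr01 r1.
have r10 : 0 < r - 1 by rewrite subr_gt0.
set K := 2 `^ _; have K0 : 0 < K by rewrite powR_gt0.
have [xK|Kx] := leP x K; first by rewrite ler_wpDr// divr_ge0// powR_ge0.
apply: ler_wpDl; first exact: ltW.
rewrite ler_pdivlMr// -(mulr_powRB1 x0 r0) ler_wpM2l//.
have <- : K `^ (r - 1) = 2 by rewrite -powRrM mulVf ?gt_eqF// powRr1.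
by rewrite ge0_ler_powR ?nnegrE ?(ltW K0) ?(ltW r10)// ltW.
Qed.

End real_inequalities.

Section Rintegral_extra.
Context d (T : measurableType d) (R : realType) (mu : {measure set T -> \bar R}).

Lemma ae_le_Rintegral (D : set T) (f g : T -> R) : measurable D ->
  mu.-integrable D (EFin \o f) -> mu.-integrable D (EFin \o g) ->
  {ae mu, forall x, D x -> f x <= g x} ->
  \int[mu]_(x in D) f x <= \int[mu]_(x in D) g x.
Proof.
move=> mD If Ig fg; rewrite -subr_ge0 -RintegralB//.
have Igf : mu.-integrable D (EFin \o (g \- f)) by exact: (integrableB mD Ig If).
rewrite /Rintegral (@ae_eq_integral _ _ _ _ _ (fun x => `|(g x - f x)%:E|)%E)//.
- by apply: fine_ge0; apply: integral_ge0.
- exact: measurable_int Igf.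
- by apply: measurableT_comp => //; exact: measurable_int Igf.
- apply: filterS fg => x fg Dx; rewrite /= ger0_norm// subr_ge0; exact: fg.
Qed.

End Rintegral_extra.

(** * Functions of zero energy *)

Section rigidity.
Context {R : realType} {n : nat}.
Notation mu := (lebesgueRn R n).
Implicit Types (x y : Rn R n) (u v f : Rn R n -> R) (s c : R).

Lemma gagliardo_ge0 s f : (0 <= gagliardo s f)%E.
Proof. by apply: integral_ge0 => z _; rewrite lee_fin gagliardo_integrand_ge0. Qed.

Lemma gagliardo_subc s f c : gagliardo s (fun x => f x - c) = gagliardo s f.
Proof.
rewrite /gagliardo; apply: eq_integral => z _.
by have -> : f z.1 - c - (f z.2 - c) = f z.1 - f z.2 by ring.
Qed.

Lemma gagliardoZ s f c : measurable_fun setT f ->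
  gagliardo s (fun x => c * f x) = ((c ^+ 2)%:E * gagliardo s f)%E.
Proof.
move=> mf; rewrite /gagliardo -ge0_integralZl_EFin ?sqr_ge0//.
- apply: eq_integral => z _; rewrite -EFinM; congr EFin.
  by rewrite -mulrBr normrM exprMn -mulrA; congr (_ * _); rewrite real_normK ?num_real.
- exact: measurable_domQ.
- by move=> z _; rewrite lee_fin gagliardo_integrand_ge0.
- apply/measurable_EFinP/measurable_funTS.
  exact: measurable_gagliardo_integrand.
Qed.

Lemma frac_kernel_neq0 s x y : 0 < s -> x <> y -> frac_kernel s x y != 0.
Proof.
move=> s0 xy; rewrite invr_eq0 powR_eq0 negb_and; apply/orP; left.
by apply/negP => /eqP/edist_eq0.
Qed.

(** By Tonelli, [\int |f x - f y|^2 k(x, y) dy = 0] for almost every [x] in the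
    ball, hence for some [x] as the ball is not null; the integration is over
    all [y] in [R^n] because [x] lies in the ball. *)
Lemma gagliardo_eq0_cst s f : (1 <= n)%N -> 0 < s -> measurable_fun setT f ->
  gagliardo s f = 0%E -> exists c, {ae mu, forall x, f x = c}.
Proof.
move=> n1 s0 mf f0.
pose G := fun z : Rn R n * Rn R n =>
  (`|f z.1 - f z.2| ^+ 2 * frac_kernel s z.1 z.2)%:E.
have mG : measurable_fun setT (G \_ domQ).
  apply/(measurable_restrictT _ _).1; first exact: measurable_domQ.
  apply/measurable_EFinP/measurable_funTS.
  exact: measurable_gagliardo_integrand.
have G0 z : (0 <= (G \_ domQ) z)%E.
  by rewrite erestrict_ge0// => ? _; rewrite lee_fin gagliardo_integrand_ge0.
have mF := measurable_fun_fubini_tonelli_F (m2 := mu) _ mG G0.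
have F0 x : (0 <= fubini_F mu (G \_ domQ) x)%E by exact: integral_ge0.
have aeF : ae_eq mu setT (fubini_F mu (G \_ domQ)) (cst 0%E).
  apply: (ae_eq_integral_abs mu measurableT mF).1.
  rewrite -[RHS]f0 /gagliardo [RHS]integral_mkcond.
  rewrite (fubini_tonelli1 (m1 := mu) (m2 := mu) _ mG G0).
  by apply: eq_integral => x _; rewrite gee0_abs.
have [x [xB Fx]] : exists x, unitB x /\ fubini_F mu (G \_ domQ) x = 0%E.
  apply: contrapT => /forallNP noB.
  have : mu.-negligible unitB.
    by apply: negligibleS aeF => x xB /= /(_ I) Fx; apply: (noB x).
  move=> /(negligibleP mu (@measurable_unitB R n))/eqP; apply/negP.
  by rewrite [X in X == _]lebesgueRn_unitB eqe gt_eqF// volB_gt0.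
have mGx : measurable_fun setT (fun y => (G \_ domQ) (x, y)).
  exact: (measurableT_comp mG (pair1_measurable x)).
exists (f x).
have aeG : ae_eq mu setT (fun y => (G \_ domQ) (x, y)) (cst 0%E).
  apply: (ae_eq_integral_abs mu measurableT mGx).1.
  by rewrite -[RHS]Fx; apply: eq_integral => y _; rewrite gee0_abs.
apply: filterS aeG => y /(_ I); rewrite patchE mem_set; last first.
  by move=> [/= + _]; exact.
move=> [/eqP]; rewrite mulf_eq0 sqrf_eq0 normr_eq0 subr_eq0 /=.
move=> /orP[/eqP->//|/eqP k0]; have [->//|xy] := pselect (x = y).
by have := frac_kernel_neq0 s0 xy; rewrite k0 eqxx.
Qed.

End rigidity.

(** * Rigidity of solutions for large diffusion *)

Section solutions.
Context {R : realType} {n : nat}.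
Notation mu := (lebesgueRn R n).
Implicit Types (x y : Rn R n) (u v f : Rn R n -> R) (s c : R).

Lemma seminormHB0E s u :
  seminormHB0 s u = (((c_ns (R := R) (n := n) s / 2)%:E * gagliardo s u) `^ 2^-1)%E.
Proof. by []. Qed.

Lemma in_HB0_gagliardo s u : 0 < c_ns (R := R) (n := n) s -> in_HB0 s u ->
  (gagliardo s u < +oo)%E.
Proof.
move=> c0 [_ _]; rewrite seminormHB0E.
have [//|] := ltP (gagliardo s u) +oo%E; rewrite leye_eq => /eqP ->.
rewrite gt0_muley; last by rewrite lte_fin divr_gt0.
by rewrite poweRyr// invr_eq0.
Qed.

Lemma in_HB0_cst s c : in_HB0 s (fun _ : Rn R n => c).
Proof.
have g0 : gagliardo s (fun _ : Rn R n => c) = 0%E.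
  by apply: integral0_eq => z _; rewrite subrr normr0 expr0n/= mul0r.
split => //.
- rewrite integral_cst; last exact: measurable_unitB.
  by rewrite lte_mul_pinfty ?lee_fin ?exprn_ge0// lebesgueRn_unitB_lty.
- by rewrite seminormHB0E g0 mule0 poweR0r// invr_eq0.
Qed.

Lemma in_HB0_subc s u c : in_HB0 s u -> in_HB0 s (fun x => u x - c).
Proof.
move=> [mu_ u2 us]; split.
- exact: measurable_funB.
- have [Iu2 Iu] := integrable_of_sqr mu_ u2.
  have mB := @measurable_unitB R n.
  have I : mu.-integrable unitB (EFin \o (fun x => 2 * u x ^+ 2 + 2 * c ^+ 2)).
    exact: (integrableD mB (integrableZl mB 2 Iu2)
      (integrable_unitB_cst (2 * c ^+ 2))).
  have muc : measurable_fun setT (fun x => u x - c) by exact: measurable_funB.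
  have mw : measurable_fun setT (fun x => (`|u x - c| ^+ 2)%:E).
    exact/measurable_EFinP/measurable_funX/(measurableT_comp _ muc).
  have := integrable_lty mB I; apply: le_lt_trans.
  apply: (ge0_le_integral mu mB).
  + by move=> x _; rewrite lee_fin exprn_ge0.
  + exact: measurable_funTS.
  + exact: measurable_int I.
  + move=> x _; rewrite lee_fin real_normK ?num_real//.
    by have := sqr_ge0 (u x + c); nra.
- by rewrite seminormHB0E gagliardo_subc -seminormHB0E.
Qed.

(** The test function [v = 1]. *)
Lemma solution_mass_identity s q d u : weak_solution s q d u ->
  mu.-integrable unitB (EFin \o (fun x => u x `^ (q - 1))) /\
  \int[mu]_(x in unitB) u x = \int[mu]_(x in unitB) u x `^ (q - 1).
Proof.
move=> [_ _ /(_ _ (in_HB0_cst s 1))[Iu]].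
rewrite (_ : \int[(mu \x mu)%E]_(z in domQ) _ = 0); last first.
  rewrite (@eq_Rintegral _ _ _ _ _ (cst 0)); last first.
    by move=> z _; rewrite subrr mulr0 mul0r.
  by rewrite Rintegral_cst ?mul0r//; exact: measurable_domQ.
rewrite mulr0 add0r => uE; split.
  apply: eq_integrable Iu => //; first exact: measurable_unitB.
  by move=> x _ /=; rewrite mulr1.
move: uE; rewrite (@eq_Rintegral _ _ _ _ _ u); last by move=> x _; rewrite mulr1.
by move=> ->; apply: eq_Rintegral => x _; rewrite mulr1.
Qed.

(** The test function [v = u - c]. *)
Lemma solution_energy_identity s q d u c : weak_solution s q d u ->
  mu.-integrable unitB (EFin \o (fun x => u x `^ (q - 1) * (u x - c))) /\
  d * (c_ns (R := R) (n := n) s / 2) * fine (gagliardo s u) +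
    \int[mu]_(x in unitB) (u x * (u x - c)) =
  \int[mu]_(x in unitB) (u x `^ (q - 1) * (u x - c)).
Proof.
move=> [uH _ /(_ _ (in_HB0_subc c uH))[Iu uE]]; split => //.
rewrite -uE; congr (_ * _ + _); congr fine; apply: eq_integral => z _.
by rewrite real_normK ?num_real//; congr EFin; ring.
Qed.

End solutions.

Section rigidity_for_large_diffusion.
Context {R : realType} {n : nat}.
Notation mu := (lebesgueRn R n).
Variables (s q : R).
Hypotheses (n_ge1 : (1 <= n)%N) (s_gt0 : 0 < s) (q_gt2 : 2 < q).

Let r := q - 1.
Let M : R := volB (R := R) (n := n).
Let K : R := 2 `^ (r - 1)^-1.

Let r_gt1 : 1 < r.
Proof. by rewrite /r; move: q_gt2; lra. Qed.

Let mB := @measurable_unitB R n.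

Lemma Rintegral_unitB_cst c : \int[mu]_(x in unitB) c = c * M.
Proof. by rewrite Rintegral_cst. Qed.

(** The integral [S] of [u], which is also that of [u^r], satisfies
    [S <= K M + S / 2] by [le_powR_half]. *)
Lemma solution_mass_le d u : weak_solution s q d u ->
  0 <= \int[mu]_(x in unitB) u x <= 2 * K * M.
Proof.
move=> us; have [uH u0 _] := us; have [mu_ u2 _] := uH.
have [Ir uE] := solution_mass_identity us.
have [_ Iu] := integrable_of_sqr mu_ u2.
have Ic := integrable_unitB_cst (n := n) K.
have Ih : mu.-integrable unitB (EFin \o (fun x => u x `^ r / 2)).
  exact: (integrableZr mB (2^-1) Ir).
have IK : mu.-integrable unitB (EFin \o (fun x => K + u x `^ r / 2)).
  exact: (integrableD mB Ic Ih).
apply/andP; split.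
  by rewrite uE; apply: Rintegral_ge0 => x _; exact: powR_ge0.
have : \int[mu]_(x in unitB) u x <= \int[mu]_(x in unitB) (K + u x `^ r / 2).
  apply: ae_le_Rintegral => //.
  by apply: filterS u0 => x ux _; exact: le_powR_half.
rewrite RintegralD// Rintegral_unitB_cst RintegralZr// -uE; lra.
Qed.

(** The energy inequality: since [u - m] has mean zero, the energy identity for
    [c = m] becomes
    [d (c_ns / 2) E + \int (u - m)^2 = \int (u^r - m^r) (u - m)],
    whose right-hand side is at most [C E] uniformly in [d] and [u]. *)
Lemma solution_energy_le : (2 * s < n%:R -> 2 * r < 2 * n%:R / (n%:R - 2 * s)) ->
  exists C, 0 < C /\ forall d (u : Rn R n -> R), weak_solution s q d u ->
    (gagliardo s u < +oo)%E ->
    d * (c_ns (R := R) (n := n) s / 2) * fine (gagliardo s u) <=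
      C * fine (gagliardo s u).
Proof.
move=> sub.
have r0 : 0 < r := lt_trans ltr01 r_gt1.
have p0 : 0 < 2 * r by rewrite mulr_gt0.
have [C [C0 sob]] := subcritical_sobolev n_ge1 s_gt0 p0 sub.
have [N rN] : exists N : nat, r <= N%:R.
  exists (Num.truncn r).+1; exact/ltW/truncnS_gt.
have M0 : 0 < M by exact: volB_gt0.
have K0 : 0 < K by rewrite powR_gt0.
(* The three terms bound the integrals of [u^r], [m^r] and [2 |w|^(2r)]. *)
pose C1 := 2 * K * M + (2 * K) `^ r * M + 2 * C.
have C10 : 0 < C1.
  rewrite /C1 ltr_wpDr ?mulr_ge0// ltr_wpDr//; last by rewrite !mulr_gt0.
  by rewrite mulr_ge0 ?powR_ge0 ?(ltW M0).
exists (N%:R * C1); split.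
  by apply: mulr_gt0 => //; apply: lt_le_trans rN.
move=> d u us gfin; have [uH u0 _] := us; have [mu_ u2 _] := uH.
have [Ir uE] := solution_mass_identity us.
have [Iu2 Iu] := integrable_of_sqr mu_ u2.
set E := fine (gagliardo s u).
have gE : gagliardo s u = E%:E by rewrite /E fineK// ge0_fin_numE// gagliardo_ge0.
have E0 : 0 <= E by rewrite fine_ge0// gagliardo_ge0.
have [->|En0] := eqVneq E 0; first by rewrite !mulr0.
have {E0}En0 : 0 < E by rewrite lt_neqAle eq_sym En0.
set S := \int[mu]_(x in unitB) u x in uE.
have /andP[S0 SK] : 0 <= S <= 2 * K * M := solution_mass_le us.
pose m := S / M.
have m0 : 0 <= m by rewrite divr_ge0// ltW.
have mK : m <= 2 * K by rewrite ler_pdivrMr.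
have mM : m * M = S by rewrite divfK// gt_eqF.
have [Irm energyE] := solution_energy_identity m us.
have Ic c := integrable_unitB_cst (R := R) (n := n) c.
pose w := fun x : Rn R n => (Num.sqrt E)^-1 * (u x - m).
have [muc uc2 _] := in_HB0_subc m uH.
have [Iuc2 Iuc] := integrable_of_sqr muc uc2.
have uc0 : \int[mu]_(x in unitB) (u x - m) = 0.
  by rewrite RintegralB// Rintegral_unitB_cst mM subrr.
have mw : measurable_fun setT w by apply: measurable_funM.
have sE : (Num.sqrt E) ^+ 2 = E by rewrite sqr_sqrtr// ltW.
have uw x : (u x - m) ^+ 2 = E * w x ^+ 2.
  by rewrite /w exprMn exprVn sE mulVKf// gt_eqF.
have w2 : (\int[mu]_(x in unitB) (`|w x| ^+ 2)%:E < +oo)%E.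
  rewrite (_ : \int[mu]_(x in unitB) _ =
      \int[mu]_(x in unitB) (E^-1%:E * (EFin \o (fun x => (u x - m) ^+ 2)%R) x))%E.
    exact/integrable_lty/integrableZl.
  apply: eq_integral => x _; rewrite real_normK ?num_real//= -EFinM uw.
  by rewrite mulKf// gt_eqF.
have w0 : \int[mu]_(x in unitB) w x = 0 by rewrite RintegralZl// uc0 mulr0.
have gw : (gagliardo s w <= 1)%E.
  rewrite /w gagliardoZ// gagliardo_subc gE exprVn sE -EFinM mulVf ?gt_eqF//.
have wC := sob w mw w2 w0 gw.
have Iw : mu.-integrable unitB (EFin \o (fun x => `|w x| `^ (2 * r))).
  apply/integrableP; split.
    apply/measurable_EFinP/measurable_funTS.
    apply: (measurableT_comp (measurable_powR _)).
    exact: (measurableT_comp (@normr_measurable R setT) mw).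
  apply: le_lt_trans (ltry C); apply: le_trans wC.
  rewrite le_eqVlt; apply/orP; left; apply/eqP.
  by apply: eq_integral => x _; rewrite /= ger0_norm// powR_ge0.
have wC' : \int[mu]_(x in unitB) `|w x| `^ (2 * r) <= C.
  by rewrite -lee_fin fineK//; exact: integrable_fin_num.
have sgn : 0 <= \int[mu]_(x in unitB) (u x * (u x - m)).
  rewrite (@eq_Rintegral _ _ _ _ _ (fun x => (u x - m) ^+ 2 + m * (u x - m))).
    rewrite RintegralD//; last exact: (integrableZl mB m Iuc).
    rewrite RintegralZl// uc0 mulr0 addr0.
    by apply: Rintegral_ge0 => x _; exact: sqr_ge0.
  by move=> x _; ring.
apply: (@le_trans _ _ (\int[mu]_(x in unitB) (u x `^ r * (u x - m)))).
  by rewrite -energyE lerDl.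
(* Subtracting [m^r] is free, as [u - m] has mean zero. *)
have Imc : mu.-integrable unitB (EFin \o (fun x => m `^ r * (u x - m))).
  exact: (integrableZl mB (m `^ r) Iuc).
have Idiff : mu.-integrable unitB
    (EFin \o (fun x => u x `^ r * (u x - m) - m `^ r * (u x - m))).
  exact: (integrableB mB Irm Imc).
have -> : \int[mu]_(x in unitB) (u x `^ r * (u x - m)) =
    \int[mu]_(x in unitB) (u x `^ r * (u x - m) - m `^ r * (u x - m)).
  by rewrite RintegralB// RintegralZl// uc0 mulr0 subr0.
have Iurm : mu.-integrable unitB (EFin \o (fun x => u x `^ r + m `^ r)).
  exact: (integrableD mB Ir (Ic _)).
have I2w : mu.-integrable unitB (EFin \o (fun x => 2 * `|w x| `^ (2 * r))).
  exact: (integrableZl mB 2 Iw).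
have Isum : mu.-integrable unitB
    (EFin \o (fun x => u x `^ r + m `^ r + 2 * `|w x| `^ (2 * r))).
  exact: (integrableD mB Iurm I2w).
apply: (@le_trans _ _ (\int[mu]_(x in unitB)
    (N%:R * E * (u x `^ r + m `^ r + 2 * `|w x| `^ (2 * r))))).
  apply: ae_le_Rintegral => //.
    exact: (integrableZl mB (N%:R * E) Isum).
  apply: filterS u0 => x ux _; rewrite -mulrBl.
  by apply: reaction_le => //; exact: ltW.
rewrite RintegralZl// RintegralD// RintegralD// RintegralZl// Rintegral_unitB_cst -uE.
rewrite mulrAC ler_wpM2r ?(ltW En0)// ler_wpM2l// /C1.
apply: lerD; last by rewrite ler_wpM2l.
apply: lerD => //; rewrite ler_wpM2r ?(ltW M0)//.
have K20 : 0 <= 2 * K by apply: mulr_ge0 => //; exact: ltW.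
exact: ge0_ler_powR (ltW r0) _ _ m0 K20 mK.
Qed.

End rigidity_for_large_diffusion.

(** The condition [q < (2^*_n + 2) / 2] amounts to [2 (q - 1) < 2^*_n]. *)
Lemma critical_exponentP (R : realType) (n : nat) (s q : R) :
  (q%:E < (critical_exponent n s + 2%:E) * (2^-1)%:E)%E -> 
  2 * s < n%:R -> 2 * (q - 1) < 2 * n%:R / (n%:R - 2 * s).
Proof.
rewrite /critical_exponent => + sn.
have -> : s < n%:R / 2 by rewrite ltr_pdivlMr// mulrC.
by rewrite -EFinD -EFinM lte_fin; lra.
Qed.

Theorem theorem1p1 (R : realType) (n : nat) (s q : R)
    (n_ge1 : (1 <= n)%N) (s_gt0 : 0 < s) (s_lt1 : s < 1) (q_gt2 : 2 < q)
    (q_lt : (q%:E < (critical_exponent n s + 2%:E) * (2^-1)%:E)%E) :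
  exists dstar : R, 0 < dstar /\
    forall d : R, dstar < d ->
    forall u : Rn R n -> R, weak_solution s q d u ->
    exists c : R, {ae lebesgueRn R n, forall x, u x = c}.
Proof.
have c0 : 0 < c_ns (R := R) (n := n) s by rewrite c_ns_gt0// s_gt0.
have [C [C0 energy]] := solution_energy_le n_ge1 s_gt0 q_gt2 (critical_exponentP q_lt).
exists (C / (c_ns (R := R) (n := n) s / 2)); split.
  by rewrite !divr_gt0.
move=> d; rewrite ltr_pdivrMr ?divr_gt0// => dC u us.
have [uH _ _] := us; have [mu_ _ _] := uH.
have gfin := in_HB0_gagliardo c0 uH.
apply: (gagliardo_eq0_cst n_ge1 s_gt0 mu_).
have g0 := gagliardo_ge0 s u.
have gE : gagliardo s u = (fine (gagliardo s u))%:E by rewrite fineK// ge0_fin_numE.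
rewrite gE; congr EFin; apply/eqP; rewrite eq_le fine_ge0// andbT.
have := energy d u us gfin.
rewrite -subr_ge0 -mulrBl => h; rewrite leNgt; apply/negP => gpos.
by move: h; rewrite pmulr_lge0// leNgt subr_lt0 dC.
Qed.
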